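(* Let $\Omega\subset\mathbb{C}$ be a simply connected domain with non-empty boundary, let $\alpha_0\in(-2,0)$, and suppose that the Inverse Brennan's Conjecture holds for the interval $[\alpha_0,2/3)$. Let $\varphi:\Omega\to\mathbb{D}$ be a conformal homeomorphism of $\Omega$ onto the unit disc and let $h(z)=J(z,\varphi)=|\varphi'(z)|^2$. Then for every $p$ with $\frac{|\alpha_0|+2}{|\alpha_0|+1}<p<2$ and every $r$ such that $$1\le r\le\frac{2p}{2-p}\cdot\frac{|\alpha_0|}{2+|\alpha_0|}<\frac{p}{2-p},$$ there is a constant $M<\infty$, not depending on $f$, such that for every function $f\in C_0^\infty(\Omega)$ $$\Bigl(\int_\Omega|f(z)|^r h(z)\,d\mu\Bigr)^{1/r}\le M\Bigl(\int_\Omega|\nabla f(z)|^p\,d\mu\Bigr)^{1/p}.$$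
   Context: $\mu$ is Lebesgue measure on $\mathbb{C}\cong\mathbb{R}^2$; $\mathbb{D}$ is the open unit disc. Functions $f$ are real-valued; $C_0^\infty(\Omega)$ is the space of smooth functions with compact support in $\Omega$. $J(z,\varphi)$ is the Jacobian of $\varphi$ at $z$; $h$ is called the conformal weight. ''The Inverse Brennan's Conjecture holds for the interval $[\alpha_0,2/3)$'' means: for every conformal homeomorphism $\psi$ of $\mathbb{D}$ onto a simply connected plane domain with non-empty boundary, $\int_{\mathbb{D}}|\psi'(w)|^{\alpha}\,d\mu<+\infty$ for all $\alpha\in[\alpha_0,2/3)$. *)

(* Defs.v *)
From HB Require Import structures.
From mathcomp Require Import all_boot all_order all_algebra.
From mathcomp Require Import complex.
From mathcomp Require Import all_classical all_reals all_analysis.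

Set Implicit Arguments.
Unset Strict Implicit.
Unset Printing Implicit Defensive.

Import Order.TTheory GRing.Theory Num.Theory.
Import numFieldNormedType.Exports.

Local Open Scope complex_scope.
Local Open Scope ring_scope.
Local Open Scope classical_set_scope.

(* The topology and the normed space structure of the field R[i] over itself. *)
HB.instance Definition _ (R : realType) := NormedModule.copy R[i] R[i]^o.

Section Plane.
Context {R : realType}.
Implicit Types (U V : set R[i]) (a : R).

(* The norm of the library on R[i] takes its values in R[i]. *)
Definition modulus (z : R[i]) : R := complex.Re `|z|.

Definition unit_disc : set R[i] := [set z | modulus z < 1].

(* Lebesgue integral over U with respect to planar Lebesgue measure, the plane
   being identified with R * R by (x, y) |-> x + i y. *)
Definition plane_integral U (g : R[i] -> \bar R) : \bar R :=
  (\int[lebesgue_measure \x lebesgue_measure]_(xy in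
      [set xy : measurableTypeR R * measurableTypeR R | U (xy.1 +i* xy.2)])
    g (xy.1 +i* xy.2))%E.

Definition domain U := [/\ open U, U !=set0 & connected U].

(* Every loop in U is homotopic in U, with fixed base point, to a constant. *)
Definition null_homotopic_loops U :=
  forall gamma : R -> R[i],
    {within `[0, 1], continuous gamma} ->
    (forall t, t \in `[0, 1] -> U (gamma t)) ->
    gamma 0 = gamma 1 ->
    exists H : R * R -> R[i],
      [/\ {within `[0, 1] `*` `[0, 1], continuous H},
          forall s t, s \in `[0, 1] -> t \in `[0, 1] -> U (H (s, t)),
          forall t, t \in `[0, 1] -> H (0, t) = gamma t,
          forall t, t \in `[0, 1] -> H (1, t) = gamma 0
        & forall s, s \in `[0, 1] -> H (s, 0) = gamma 0 /\ H (s, 1) = gamma 0].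

Definition simply_connected_domain U := domain U /\ null_homotopic_loops U.

Definition boundary U : set R[i] := closure U `\` interior U.

Definition homeomorphism U V (f : R[i] -> R[i]) :=
  exists g : R[i] -> R[i],
    [/\ {within U, continuous f}, {within V, continuous g},
        forall z, U z -> V (f z) /\ g (f z) = z
      & forall w, V w -> U (g w) /\ f (g w) = w].

(* Over the field R[i], [derivable] and [derive1] are complex differentiability
   and the complex derivative. *)
Definition conformal U (f : R[i] -> R[i]) :=
  forall z, U z -> derivable f z 1 /\ derive1 f z != 0.

Definition conformal_homeomorphism U V (f : R[i] -> R[i]) :=
  conformal U f /\ homeomorphism U V f.

Definition inverse_brennan a :=
  forall (U : set R[i]) (psi : R[i] -> R[i]),
    simply_connected_domain U -> boundary U !=set0 ->
    conformal_homeomorphism unit_disc U psi ->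
    forall alpha : R, a <= alpha < 2 / 3 ->
      (plane_integral unit_disc
         (fun w => (modulus (derive1 psi w) `^ alpha)%:E) < +oo)%E.

Definition partialx (f : R[i] -> R) (z : R[i]) : R :=
  derive1 (fun t : R => f (t +i* complex.Im z)) (complex.Re z).

Definition partialy (f : R[i] -> R) (z : R[i]) : R :=
  derive1 (fun t : R => f (complex.Re z +i* t)) (complex.Im z).

Definition jacobian_det (f : R[i] -> R[i]) (z : R[i]) : R :=
  let u w := complex.Re (f w) in
  let v w := complex.Im (f w) in
  partialx u z * partialy v z - partialy u z * partialx v z.

Definition grad_norm (f : R[i] -> R) (z : R[i]) : R :=
  Num.sqrt (partialx f z ^+ 2 + partialy f z ^+ 2).

Fixpoint Ck (k : nat) (f : R[i] -> R) : Prop :=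
  continuous f /\
  if k is k'.+1 then
    [/\ forall z, derivable (fun t : R => f (t +i* complex.Im z)) (complex.Re z) 1,
        forall z, derivable (fun t : R => f (complex.Re z +i* t)) (complex.Im z) 1,
        Ck k' (partialx f) & Ck k' (partialy f)]
  else True.

Definition smooth (f : R[i] -> R) := forall k, Ck k f.

Definition support (f : R[i] -> R) : set R[i] := closure [set z | f z != 0].

(* Elements of C_0^oo(U) are extended by zero to the whole plane. *)
Definition test_function U (f : R[i] -> R) :=
  [/\ smooth f, compact (support f) & support f `<=` U].

Lemma modE (x y : R) : modulus (x +i* y) = Num.sqrt (x ^+ 2 + y ^+ 2).
Proof. by []. Qed.

Lemma modReIm (w : R[i]) :
  `|complex.Re w| <= modulus w /\ `|complex.Im w| <= modulus w.
Proof.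
case: w => a b; rewrite modE /= -!sqrtr_sqr; split; apply: ler_wsqrtr;
  rewrite ?lerDl ?lerDr sqr_ge0 //.
Qed.

Lemma norm_modulus (w : R[i]) : `|w| = (modulus w)%:C.
Proof. by case: w. Qed.

Lemma cvg_ReIm (g : R[i] -> R[i]) (l : R[i]) (e : R -> R[i]) :
  (forall t, modulus (e t) = `|t|) ->
  g @ 0^' --> l ->
  (fun t : R => complex.Re (g (e t))) @ 0^' --> complex.Re l /\
  (fun t : R => complex.Im (g (e t))) @ 0^' --> complex.Im l.
Proof.
move=> he gl.
have H : forall eps : R, 0 < eps -> \forall t \near (0:R)^', modulus (g (e t) - l) < eps.
  move=> eps eps0.
  have : \forall h \near (0:R[i])^', `|l - g h| < eps%:C.
    by move/cvgrPdist_lt : gl; apply; rewrite ltcR.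
  move=> /nbhs_ballP[d /= d0 dP].
  have [d1 d1E] : exists d1 : R, d = d1%:C.
    exists (complex.Re d); case: d d0 {dP} => a b; by rewrite ltcE /= => /andP[/eqP -> _].
  apply/nbhs_ballP; exists d1 => /=.
    by move: d0; rewrite d1E ltcR.
  move=> t /= td t0.
  have mC (w v : R[i]) : modulus (w - v) = modulus (v - w) by rewrite /modulus distrC.
  have : `|l - g (e t)| < eps%:C.
    apply: dP.
      rewrite /ball /= sub0r normrN norm_modulus he d1E ltcR.
      by move: td; rewrite /ball /= sub0r normrN.
    apply/eqP => et0; have := he t; rewrite et0 /modulus normr0 => /esym/eqP.
    by rewrite normr_eq0; apply/negP.
  by rewrite norm_modulus ltcR mC.
split; apply/cvgrPdist_lt => eps eps0; near=> t.
- have : modulus (g (e t) - l) < eps by near: t; exact: H.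
  apply: le_lt_trans; rewrite distrC.
  have -> : complex.Re (g (e t)) - complex.Re l = complex.Re (g (e t) - l).
    by case: (g (e t)) => ? ?; case: (l) => ? ?.
  exact: (modReIm _).1.
- have : modulus (g (e t) - l) < eps by near: t; exact: H.
  apply: le_lt_trans; rewrite distrC.
  have -> : complex.Im (g (e t)) - complex.Im l = complex.Im (g (e t) - l).
    by case: (g (e t)) => ? ?; case: (l) => ? ?.
  exact: (modReIm _).2.
Unshelve. all: by end_near.
Qed.

Lemma cvg_derive1 (f : R[i] -> R[i]) (z : R[i]) : derivable f z 1 ->
  (fun h : R[i] => h^-1 *: (f (h + z) - f z)) @ 0^' --> derive1 f z.
Proof.
rewrite derive1E /derive => /cvg_ex[l hl].
have E : (fun h : R[i] => h^-1 *: (f (h *: (1:R[i]) + z) - f z))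
    = (fun h : R[i] => h^-1 *: (f (h + z) - f z)).
  by apply/funext => h; congr (_ *: (f (_ + _) - _)); rewrite /GRing.scale /= mulr1.
rewrite /= E in hl *.
by rewrite (cvg_lim _ hl).
Qed.

(* For a holomorphic function, the Cauchy-Riemann equations give J = |f'|^2. *)
Lemma jacobian_detE (f : R[i] -> R[i]) (z : R[i]) :
  derivable f z 1 -> jacobian_det f z = modulus (derive1 f z) ^+ 2.
Proof.
move=> /cvg_derive1; move: (derive1 f z) => L fL.
have mr t : modulus (t%:C : R[i]) = `|t|.
  by rewrite modE expr0n /= addr0 sqrtr_sqr.
have mi t : modulus ((0 +i* t) : R[i]) = `|t|.
  by rewrite modE expr0n /= add0r sqrtr_sqr.
have [ux vx] := cvg_ReIm mr fL.
have [uy vy] := cvg_ReIm mi fL.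
have ir (t : R) : (t%:C : R[i])^-1 = (t^-1)%:C by rewrite fmorphV.
have ii (t : R) : ((0 +i* t) : R[i])^-1 = 0 -i* t^-1.
  rewrite /GRing.inv /= expr0n /= add0r mul0r.
  have -> : t / t ^+ 2 = t^-1 by have [->|t0] := eqVneq t 0;
    [rewrite mul0r invr0 | rewrite expr2 invfM mulrA mulfV // mul1r].
  by [].
have zE : complex.Re z +i* complex.Im z = z by case: (z).
have aE (a b c d : R) : (a +i* b) + (c +i* d) = (a + c) +i* (b + d) by [].
have Ex (t : R) : t%:C + z = (t + complex.Re z) +i* complex.Im z.
  by rewrite -{1}zE aE add0r.
have Ey (t : R) : (0 +i* t) + z = complex.Re z +i* (t + complex.Im z).
  by rewrite -{1}zE aE add0r.
have q1 : partialx (fun w => complex.Re (f w)) z = complex.Re L.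
  apply/cvg_lim => //; apply: cvg_trans ux; apply: near_eq_cvg; near=> t.
  rewrite Ex ir zE; case: (f (_ +i* _)) => a b; case: (f z) => c d.
  by rewrite /GRing.scale /= mul0r subr0.
have q2 : partialx (fun w => complex.Im (f w)) z = complex.Im L.
  apply/cvg_lim => //; apply: cvg_trans vx; apply: near_eq_cvg; near=> t.
  rewrite Ex ir zE; case: (f (_ +i* _)) => a b; case: (f z) => c d.
  by rewrite /GRing.scale /= mul0r addr0.
have q3 : partialy (fun w => complex.Re (f w)) z = - complex.Im L.
  apply/cvg_lim => //; rewrite -[X in _ --> X]/(- complex.Im L).
  apply: cvg_trans (cvgN vy); apply: near_eq_cvg; near=> t.
  rewrite -[LHS]/(- complex.Im ((0 +i* t)^-1 *: (f ((0 +i* t) + z) - f z))).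
  rewrite Ey ii zE; case: (f (_ +i* _)) => a b; case: (f z) => c d.
  by rewrite /GRing.scale /= mul0r add0r mulNr opprK.
have q4 : partialy (fun w => complex.Im (f w)) z = complex.Re L.
  apply/cvg_lim => //; apply: cvg_trans uy; apply: near_eq_cvg; near=> t.
  rewrite /= Ey ii zE; case: (f (_ +i* _)) => a b; case: (f z) => c d.
  by rewrite /GRing.scale /= mul0r sub0r mulNr opprK.
rewrite /jacobian_det q1 q2 q3 q4.
case: (L) => a b; rewrite modE sqr_sqrtr ?addr_ge0 ?sqr_ge0 //=.
by rewrite mulNr opprK !expr2.
Unshelve. all: by end_near.
Qed.

End Plane.

(* Main.v *)
Require Import Defs.
From HB Require Import structures.
From mathcomp Require Import all_boot all_order all_algebra.
From mathcomp Require Import complex.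
From mathcomp Require Import all_classical all_reals all_analysis.
From mathcomp Require Import measurable_realfun lra ring.
Import Order.TTheory GRing.Theory Num.Theory.
Import numFieldNormedType.Exports.
Local Open Scope classical_set_scope.
Local Open Scope ring_scope.
Local Open Scope complex_scope.

Set Implicit Arguments.
Unset Strict Implicit.
Unset Printing Implicit Defensive.

(** Let [psi] be the inverse of [phi], from the disc to [Omega], and [a = |alpha0|].  For a test
    function [f], the inequality is obtained by moving [f] to the disc, using the
    planar Sobolev inequality there, and moving the gradient back.  The exponent of
    the Sobolev step is [q = p a / (2 - p + a)]: the lower bound on [p] is [1 < q],
    the bound [p < 2] is [q < p], and the upper bound on [r] is the Sobolev exponent
    [2 q / (2 - q)].  With [g = f \o psi], extended by zero,
    - the weight [h = |phi'| ^ 2] is the Jacobian, so the left-hand side is comparable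
      to the norm of [g] in [L^r] of the disc ([conformal_change]);
    - the disc has finite area, so this is at most a constant times the norm of [g]
      in [L^(2 q / (2 - q))] ([integral_power_le]);
    - by the Gagliardo-Nirenberg-Sobolev inequality for compactly supported
      functions, that norm is at most a constant times the norm in [L^q] of the
      gradient of [g], which is [|grad f| \o psi] times [|psi'|] up to constants
      ([sobolev], [upper_slope_transplant]);
    - Hoelder's inequality with exponents [p / q] and [p / (p - q)] separates the
      integral of [(|grad f| \o psi) ^ p * |psi'| ^ 2] from that of
      [|psi'| ^ alpha0] ([hoelder_weight]).  The second one is finite by the inverse
      Brennan conjecture at the exponent [alpha0], and does not depend on [f];
    - the first one is comparable to the integral of [|grad f| ^ p] over [Omega]
      ([conformal_change] again, with the roles of [phi] and [psi] exchanged).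

    No constant has to be sharp, so a one-sided change of variables suffices: the
    integral after substitution is at most a constant times the expected one.
    Applied to [phi] and to [psi], it gives both comparisons.

    Both this inequality and the one-dimensional fundamental theorem of calculus
    behind the Sobolev inequality come from one principle ([square_majorization]):
    a function of squares that is subadditive under cutting into four quarters, and
    is at most [M] times the area on small squares around [z] whenever [u z < M], is
    bounded on each square by the integral of [u].  As in the proof of the
    Vitali-Caratheodory theorem, a measurable [u] is first replaced by a measure that
    strictly dominates it around every point at an arbitrarily small cost
    ([lower_majorant]); a square violating the bound then has a violating quarter,
    and nested violating squares shrink to a point where this is absurd.  For a
    conformal map, only the growth around each point matters, and that is given by
    its derivative there; continuity of the derivative does not enter. *)

(** * Regularity of finite measures on the plane *)

Notation plane R := (measurableTypeR R * measurableTypeR R)%type.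

Section regularity.
Context {R : realType}.
Implicit Types (A F G : set (R * R)).

Lemma measurable_plane_ball (c : R * R) (e : R) :
  measurable (ball c e : set (plane R)).
Proof.
have -> : ball c e = ball c.1 e `*` ball c.2 e by [].
by apply: measurableX; exact: measurable_ball.
Qed.

Lemma open_measurable_plane G : open G -> measurable (G : set (plane R)).
Proof.
move=> oG.
pose B (i : rat * rat * nat) := ball (ratr i.1.1 : R, ratr i.1.2 : R) i.2.+1%:R^-1.
have -> : G = \bigcup_i (B i `&` [set _ | B i `<=` G]).
  apply/seteqP; split => [z Gz|z [i _ [Biz BG]]]; last exact: BG.
  have /nbhs_ballP[e /= e0 eG] : nbhs z G by exact: open_nbhs_nbhs.
  have [n _ /(_ n (leqnn n)) /= nle] :=
    near_infty_natSinv_lt (PosNum (divr_gt0 e0 (ltr0Sn R 1))).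
  have n0 : (0 : R) < n.+1%:R^-1 by rewrite invr_gt0 ltr0Sn.
  have H (x : R) : exists q : rat, `|ratr q - x| < n.+1%:R^-1.
    have lx : x - n.+1%:R^-1 < x by rewrite ltrBlDr ltrDl.
    have [q] := rat_in_itvoo lx.
    by rewrite in_itv /= => /andP[h1 h2]; exists q;
      rewrite distrC ltr_distlC h1 /= (lt_trans h2)// ltrDl.
  have [q1 h1] := H z.1; have [q2 h2] := H z.2.
  have tri (x y c : R) : `|c - x| < n.+1%:R^-1 -> `|c - y| < n.+1%:R^-1 -> `|x - y| < e.
    by move=> cx cy; rewrite (splitr e) (le_lt_trans (ler_distD c _ _))// ltrD//;
      [rewrite distrC|]; exact: lt_trans nle.
  exists (q1, q2, n) => //; split; first by split.
  by move=> w [/= w1 w2]; apply: eG; split; apply: tri; eassumption.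
apply: countable_bigcupT_measurable => [|i]; first exact/countableP.
apply: measurableI; first exact: measurable_plane_ball.
have [h|h] := pselect (B i `<=` G).
- by rewrite (_ : [set _ | _] = setT)//; apply/seteqP; split.
- by rewrite (_ : [set _ | _] = set0)//; apply/seteqP; split.
Qed.

Lemma closed_measurable_plane F : closed F -> measurable (F : set (plane R)).
Proof.
by move=> cF; rewrite -[F]setCK; apply: measurableC;
  apply: open_measurable_plane; exact: closed_openC.
Qed.

(** These sets form a sigma-algebra containing preimages of Borel sets by the two
    coordinates, hence every measurable set is one of them. *)
Definition regular_for (m : {measure set (plane R) -> \bar R}) A :=
  forall e : R, 0 < e -> exists F G, [/\ closed F, open G, F `<=` A, A `<=` G &
    (m (G `\` F) < e%:E)%E].

Section finite.
Variable m : {measure set (plane R) -> \bar R}.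
Hypothesis mfin : (m setT < +oo)%E.

Let reg_measurable G F : open G -> closed F -> measurable (G `\` F : set (plane R)).
Proof.
by move=> oG cF; apply: measurableD;
  [exact: open_measurable_plane | exact: closed_measurable_plane].
Qed.

Let cvg_small (D : (set (plane R))^nat) (e : R) : 0 < e -> (forall n, measurable (D n)) ->
  nonincreasing_seq D -> (m (\bigcap_n D n) < e%:E)%E -> exists n, (m (D n) < e%:E)%E.
Proof.
move=> e0 mD nD De.
have D0 : (m (D 0%N) < +oo)%E.
  by apply: le_lt_trans mfin; apply: le_measure; rewrite ?inE.
have mI : measurable (\bigcap_n D n) by exact: bigcapT_measurable.
have := nonincreasing_cvg_mu D0 mD mI nD.
move=> /(_ _ (open_ereal_lt_ereal De)).
by case=> n _ /(_ n (leqnn n)) ?; exists n.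
Qed.

(** A closed set is the intersection of its open neighbourhoods of radius
    [1 / (n + 1)], whose measures decrease to its own because [m] is finite. *)
Lemma regular_closed F : closed F -> regular_for m F.
Proof.
move=> cF e e0.
pose G (n : nat) := \bigcup_(z in F) ball z (n.+1%:R^-1 : R).
have oG n : open (G n).
  by apply: bigcup_open => z _; exact: ball_open.
have FG n : F `<=` G n by move=> z Fz; exists z => //; exact: ballxx.
have : exists n, (m (G n `\` F) < e%:E)%E.
  apply: cvg_small => // [n|a b ab|].
  - exact: reg_measurable.
  - apply/subsetPset => z [[w Fw wz] Fz]; split => //; exists w => //.
    by apply: le_ball wz; rewrite lef_pV2 ?posrE// ler_nat.
  - rewrite (_ : bigcap _ _ = set0) ?measure0 ?lte_fin//.
    apply/seteqP; split=> // z Gz.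
    have Fz : ~ F z by case: (Gz 0%N I).
    have : nbhs z (~` F) by apply: open_nbhs_nbhs; split => //; exact: closed_openC.
    move=> /nbhs_ballP[d /= d0 dF].
    have [n _ /(_ n (leqnn n)) /= nd] := near_infty_natSinv_lt (PosNum d0).
    have [[w Fw wz] _] := Gz n I.
    apply: (dF w) => //; apply: ball_sym; apply: le_ball wz; exact: ltW.
case=> n ?; exists F, (G n); split => //.
Qed.

Lemma regularC A : regular_for m A -> regular_for m (~` A).
Proof.
move=> rA e e0; have [F [G [cF oG FA AG mGF]]] := rA e e0.
exists (~` G), (~` F); split; [exact: open_closedC|exact: closed_openC| | |].
- exact: subsetC.
- exact: subsetC.
- by rewrite setDE setCK setIC -setDE.
Qed.

(** The outer sets are taken with errors summing to [e / 2]; the union of all inner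
    sets need not be closed, hence the finite unions [H n], which exhaust it. *)
Lemma regular_bigcup (A : (set (R * R))^nat) :
  (forall n, regular_for m (A n)) -> regular_for m (\bigcup_n A n).
Proof.
move=> rA e e0.
have e4 n : 0 < e / 2 / (2 ^ n.+1)%:R by rewrite !divr_gt0// ltr0n expn_gt0.
pose P n (FG : set (R * R) * set (R * R)) := [/\ closed FG.1, open FG.2,
  FG.1 `<=` A n, A n `<=` FG.2 & (m (FG.2 `\` FG.1) < (e / 2 / (2 ^ n.+1)%:R)%:E)%E].
have /choice[f fP] : forall n, exists FG, P n FG.
  by move=> n; have [F [G h]] := rA n _ (e4 n); exists (F, G).
pose G := \bigcup_n (f n).2.
pose H n := \big[setU/set0]_(i < n) (f i).1.
have oG : open G by apply: bigcup_open => n _; have [] := fP n.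
have cH n : closed (H n).
  rewrite /H; elim/big_ind : _ => [|X Y|i _]; [exact: closed0|exact: closedU|].
  by have [] := fP i.
have [n mn] : exists n, (m (G `\` H n) < e%:E)%E.
  apply: cvg_small => // [n|a b ab|].
  - exact: reg_measurable.
  - apply/subsetPset => z [Gz Hz]; split => // Hz'; apply: Hz; move: Hz'.
    rewrite /H -!(bigcup_mkord _ (fun n => (f n).1)) => -[i /= ia fi].
    by exists i => //=; exact: leq_trans ia ab.
  - have -> : \bigcap_n (G `\` H n) = G `\` \bigcup_n (f n).1.
      apply/seteqP; split=> [z Hz|z [Gz Fz] n _].
        split=> [|[n _ fz]]; first by case: (Hz 0%N I).
        by have [_] := Hz n.+1 I; apply; rewrite /H -(bigcup_mkord _ (fun n => (f n).1));
          exists n => /=.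
      split => //; rewrite /H -(bigcup_mkord _ (fun n => (f n).1)) => -[i _ ?]; apply: Fz.
      by exists i.
    apply: (@le_lt_trans _ _ (\sum_(n <oo) m ((f n).2 `\` (f n).1))%E).
      apply: measure_sigma_subadditive => [n||z [[n _ fz] Fz]].
      + by apply: reg_measurable; have [] := fP n.
      + apply: measurableD; first exact: open_measurable_plane.
        by apply: bigcupT_measurable => n; apply: closed_measurable_plane; have [] := fP n.
      + by exists n => //; split => // ?; apply: Fz; exists n.
    apply: (@le_lt_trans _ _ (e / 2)%:E); last by rewrite lte_fin; lra.
    apply: (le_trans _ (epsilon_trick0 xpredT _)); last by lra.
    apply: lee_nneseries => // n _; apply: ltW.
    by have [] := fP n.
exists (H n), G; split => //.
- rewrite /H; elim/big_ind : _ => // [X Y XA YA z [/XA|/YA]//|i _ z Fz].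
  by exists i => //; have [_ _ h _ _] := fP i; exact: h.
- by move=> z [i _ Az]; exists i => //; have [_ _ _ h _] := fP i; exact: h.
Qed.

Lemma regular_sigma_algebra : sigma_algebra setT (regular_for m).
Proof.
split.
- by apply: regular_closed; exact: closed0.
- by move=> A rA; rewrite setTD; exact: regularC.
- exact: regular_bigcup.
Qed.

Lemma regular_preimage (f : R * R -> R) (X : set R) : continuous f ->
  measurable X -> regular_for m (f @^-1` X).
Proof.
move=> cf.
have sI := sigma_algebra_image f regular_sigma_algebra.
move=> mX; have {}mX : (@RGenOpens.G R).-sigma.-measurable X.
  by rewrite -RGenOpens.measurableE.
suff : (@RGenOpens.G R).-sigma.-measurable `<=` image_set_system setT f (regular_for m).
  by move=> /(_ _ mX); rewrite /image_set_system /= setTI.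
apply: smallest_sub => // _ [x [y ->]].
rewrite /image_set_system /= setTI -[X in regular_for _ X]setCK.
apply/regularC/regular_closed/open_closedC/open_comp => // *; exact: cf.
Qed.

Lemma finite_measure_regular A : measurable (A : set (plane R)) -> regular_for m A.
Proof.
suff : @measurable _ (plane R) `<=` regular_for m by apply.
apply: smallest_sub; first exact: regular_sigma_algebra.
move=> _ [] [X mX <-]; rewrite setTI.
- by apply: (@regular_preimage fst X) => // z; exact: cvg_fst.
- by apply: (@regular_preimage snd X) => // z; exact: cvg_snd.
Qed.

End finite.
End regularity.

(** * The majorization principle on squares *)

Section squares.
Context {R : realType}.
Local Notation mu := (@lebesgue_measure R \x @lebesgue_measure R)%E.
Implicit Types (a z : R * R) (s : R) (u : R * R -> R).

(** Half-open squares, whose four quarters are disjoint; the limit of nested squares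
    is only guaranteed to lie in the closed ones. *)
Definition square a s : set (R * R) :=
  `[a.1, a.1 + s[%classic `*` `[a.2, a.2 + s[%classic.

Definition closed_square a s : set (R * R) :=
  `[a.1, a.1 + s]%classic `*` `[a.2, a.2 + s]%classic.

Lemma measurable_square a s : measurable (square a s : set (plane R)).
Proof. by apply: measurableX; exact: measurable_itv. Qed.

Lemma area_square a s : 0 <= s -> mu (square a s) = (s ^+ 2)%:E.
Proof.
move=> s0; rewrite /square product_measure1E; try exact: measurable_itv.
have H x : lebesgue_measure (`[x, x + s[%classic : set (measurableTypeR R)) = s%:E.
  rewrite lebesgue_measure_itv /= lte_fin ltrDl -EFinB.
  by case: ltgtP s0 => // [_ _|<- _]; first by congr EFin; ring.
by rewrite expr2 EFinM; congr (_ * _)%E; exact: H.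
Qed.

(** Cut [u] into the level sets [A k] on which it lies between [k h] and [(k + 1) h],
    enlarge each to an open set [G k], and let [W] be the sum of the areas inside the
    [G k], weighted by [(k + 1) h].  Openness of [G k] turns the bound
    [u z < (k + 1) h] at one point into a lower bound on [W] near that point. *)
Lemma lower_majorant (Q : set (plane R)) u (e : R) :
  measurable Q -> (mu Q < +oo)%E -> measurable_fun setT (u : plane R -> R) ->
  (forall z, 0 <= u z) -> 0 < e ->
  exists W : {measure set (plane R) -> \bar R},
    (W Q <= \int[mu]_(z in Q) (u z)%:E + e%:E)%E /\
    forall z, exists M d : R, [/\ u z < M, 0 < d &
      forall S : set (plane R), measurable S -> S `<=` ball z d ->
        (M%:E * mu S <= W S)%E].
Proof.
move=> mQ Qfin um u0 e0.
pose m := fine (mu Q).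
have mE : mu Q = m%:E by rewrite fineK// ge0_fin_numE.
have m0 : 0 <= m by rewrite fine_ge0.
(* rounding [u] up costs [h * m], enlarging the level sets costs [h] *)
pose h := e / (m + 1).
have h0 : 0 < h by rewrite divr_gt0// ltr_wpDl.
pose A k : set (plane R) := u @^-1` `[k%:R * h, k.+1%:R * h[%classic.
have mA k : measurable (A k).
  by rewrite -[A k]setTI; apply: um => //; exact: measurable_itv.
have AE z k : A k z -> k = Num.truncn (u z / h).
  rewrite /A /= in_itv /= => /andP[h1 h2]; apply/esym/truncn_def.
  by rewrite ler_pdivlMr// ltr_pdivrMr// h1.
have Az z : A (Num.truncn (u z / h)) z.
  have := @truncn_itv _ (u z / h); rewrite divr_ge0 ?(ltW h0)// => /(_ isT).
  by rewrite ler_pdivlMr// ltr_pdivrMr// /A /= in_itv.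
pose c k := (k.+1%:R * h)%R.
have c0 k : 0 < c k by rewrite mulr_gt0.
(* the weighted excess [c k * d k] of the [k]-th set sums to [h] *)
pose d k := h / (2 ^ k.+1)%:R / c k.
have d0 k : 0 < d k by apply: divr_gt0 => //; apply: divr_gt0 => //; rewrite ltr0n expn_gt0.
pose mQr := mrestr mu mQ.
have mQr_fin : (mQr setT < +oo)%E by rewrite /mQr /mrestr setTI.
have /choice[G GP] k : exists G,
    [/\ open G, A k `<=` G & (mu (G `&` Q) <= mu (A k `&` Q) + (d k)%:E)%E].
  have [F [G [cF oG FA AG FG]]] := finite_measure_regular mQr_fin (mA k) (d0 k).
  exists G; split => //.
  have mG := open_measurable_plane oG; have mF := closed_measurable_plane cF.
  have -> : G `&` Q = (A k `&` Q) `|` ((G `\` A k) `&` Q).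
    by rewrite -setIUl setDUK.
  apply: le_trans (measureU2 _ _ _) _; try by apply: measurableI => //; exact: measurableD.
  rewrite leeD2l//; apply/ltW; apply: le_lt_trans FG.
  rewrite /mQr /mrestr; apply: le_measure; rewrite ?inE.
  - by apply: measurableI => //; exact: measurableD.
  - by apply: measurableI => //; exact: measurableD.
  - by apply: setSI; apply: setDS.
have mG k : measurable (G k : set (plane R)) by apply: open_measurable_plane; have [] := GP k.
pose W := mseries (fun k => mscale (NngNum (ltW (c0 k))) (mrestr mu (mG k))) 0.
exists W; split; last first.
  move=> z; pose k := Num.truncn (u z / h).
  have [oG AG _] := GP k.
  have /nbhs_ballP[r /= r0 rG] : nbhs z (G k).
    by apply: open_nbhs_nbhs; split => //; apply: AG; exact: Az.
  exists (c k), r; split => //.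
    by have := Az z; rewrite /A /= in_itv /= => /andP[].
  move=> S mS Sb; rewrite /W /mseries /=.
  apply: le_trans (nneseries_lim_ge k.+1 _) => //.
  rewrite big_nat_recr//= /mscale /= /mrestr (_ : S `&` G k = S); last first.
    by apply/setIidPl; apply: subset_trans Sb rG.
  by rewrite leeDr// sume_ge0// => i _; rewrite mule_ge0// lee_fin ltW.
apply: (@le_trans _ _ (\sum_(k <oo) ((c k)%:E * mu (A k `&` Q) + (h / (2 ^ k.+1)%:R)%:E))%E).
  apply: lee_nneseries => k _; first by rewrite mule_ge0// lee_fin ltW.
  rewrite -[leLHS]/((c k)%:E * mu (Q `&` G k))%E [Q `&` _]setIC; have [_ _ GA] := GP k.
  apply: (le_trans (lee_wpmul2l _ GA)); first by rewrite lee_fin ltW.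
  rewrite ge0_muleDr//; last by rewrite lee_fin ltW.
  apply: leeD2l; rewrite -EFinM lee_fin /d mulrCA mulfV ?mulr1//.
  by rewrite gt_eqF.
apply: (le_trans (epsilon_trick _ _ (ltW h0))).
  by move=> k; rewrite mule_ge0// lee_fin ltW.
have step : (\sum_(k <oo) ((c k)%:E * mu (A k `&` Q)) <= \int[mu]_(z in Q) (u z)%:E + (h * m)%:E)%E.
  have QE : Q = \bigcup_k (A k `&` Q).
    by rewrite -setI_bigcupl; apply/esym/setIidPr => z Qz; eexists.
  have um' D : measurable_fun D (fun z => (u z)%:E : \bar R).
    by apply/measurable_EFinP; exact: measurable_funTS.
  rewrite EFinM -mE -integral_cst// -ge0_integralD//;
    [|by move=> z _; rewrite lee_fin|exact: um'|by move=> z _; rewrite lee_fin ltW].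
  rewrite [in leRHS]QE ge0_integral_bigcup; last first.
  - apply/trivIsetP => i j _ _ ij; rewrite -subset0 => z [[/AE iz _] [/AE jz _]].
    by move: ij; rewrite iz jz eqxx.
  - by move=> z _; rewrite adde_ge0// lee_fin// ltW.
  - by apply: emeasurable_funD; [exact: um'|exact: measurable_cst].
  - by move=> k; exact: measurableI.
  apply: lee_nneseries => [k _|k _]; first by rewrite mule_ge0// lee_fin ltW.
  rewrite -integral_cst; last exact: measurableI.
  apply: ge0_le_integral => //.
  - exact: measurableI.
  - by move=> z _; rewrite lee_fin ltW.
  - by apply: emeasurable_funD; [exact: um'|exact: measurable_cst].
  - move=> z [+ _]; rewrite /A /= in_itv /= => /andP[h1 _].
    by rewrite -EFinD lee_fin /c -natr1 mulrDl mul1r lerD2r.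
apply: (le_trans (leeD2r _ step)).
rewrite -addeA leeD2l// -EFinD lee_fin -[X in _ + X]mulr1 -mulrDr /h.
by rewrite divfK// gt_eqF// ltr_wpDl.
Qed.

(** A square on which [nu] exceeds the measure [W] of [lower_majorant] has such a
    quarter, by subadditivity of [nu] and additivity of [W].  Iterating, the closed
    squares shrink to a point [z], near which [W] is at least [M] times the area for
    some [M > u z], while [nu] is at most that: a contradiction. *)
Lemma square_majorization (nu : R * R -> R -> \bar R) (u : R * R -> R) a0 s0 :
  0 < s0 -> measurable_fun setT (u : plane R -> R) -> (forall z, 0 <= u z) ->
  (forall a s, 0 < s -> (nu a s <=
     nu a (s / 2)%R + nu (a.1 + s / 2, a.2)%R (s / 2)%R +
     (nu (a.1, a.2 + s / 2)%R (s / 2)%R + nu (a.1 + s / 2, a.2 + s / 2)%R (s / 2)%R))%E) ->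
  (forall z M, closed_square a0 s0 z -> u z < M ->
     exists2 d, 0 < d & forall a s, 0 < s < d -> closed_square a s z ->
       (nu a s <= (M * s ^+ 2)%:E)%E) ->
  (nu a0 s0 <= \int[mu]_(z in square a0 s0) (u z)%:E)%E.
Proof.
move=> s00 um u0 nu_sub nu_loc.
apply/lee_addgt0Pr => e e0.
have mQ := measurable_square a0 s0.
have Qfin : (mu (square a0 s0) < +oo)%E by rewrite area_square ?ltry// ltW.
have [W [WQ WP]] := lower_majorant mQ Qfin um u0 e0.
apply: le_trans WQ; rewrite leNgt; apply/negP => bad0.
pose bad (x : R * R * R) := (W (square x.1 x.2) < nu x.1 x.2)%E.
(* the four corners are described by inequalities, so that quarters need not be
   enumerated when coordinates of nested squares are compared *)
have step (x : R * R * R) : exists y, 0 < x.2 -> bad x ->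
  [/\ bad y, y.2 = x.2 / 2, x.1.1 <= y.1.1 <= x.1.1 + x.2 / 2 &
     x.1.2 <= y.1.2 <= x.1.2 + x.2 / 2].
  case: x => -[a1 a2] s /=.
  have [[s_gt0 badx]|/not_andP h] := pselect (0 < s /\ bad (a1, a2, s)); last first.
    by exists (a1, a2, s) => ? ?; case: h.
  have t0 : 0 < s / 2 by rewrite divr_gt0.
  apply: contrapT => /forallNP nobad.
  have good y1 y2 : a1 <= y1 <= a1 + s / 2 -> a2 <= y2 <= a2 + s / 2 ->
      (nu (y1, y2) (s / 2)%R <= W (square (y1, y2) (s / 2)%R))%E.
    move=> h1 h2; rewrite leNgt; apply/negP => h3.
    by apply: (nobad (y1, y2, s / 2)).
  have le1 (x : R) : x <= x <= x + s / 2 by rewrite lexx lerDl ltW.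
  have le2 (x : R) : x <= x + s / 2 <= x + s / 2 by rewrite lexx lerDl ltW.
  have mS a t : measurable (square a t : set (plane R)) := measurable_square a t.
  move: badx; rewrite /bad /= ltNge => /negP; apply.
  apply: (le_trans (nu_sub _ _ s_gt0)) => /=.
  pose t := s / 2; have tE : s = t + t by rewrite /t -splitr.
  pose X1 := square (a1, a2) t; pose X2 := square (a1 + t, a2) t.
  pose X3 := square (a1, a2 + t) t; pose X4 := square (a1 + t, a2 + t) t.
  have sqE b1 b2 z : square (b1, b2) t z ->
      [/\ b1 <= z.1, z.1 < b1 + t, b2 <= z.2 & z.2 < b2 + t].
    by case=> /=; rewrite !in_itv /= => /andP[? ?] /andP[? ?].
  apply: (@le_trans _ _ (W (X1 `|` X2) + W (X3 `|` X4))%E).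
    rewrite !measureU; try exact: mS.
    - by rewrite !leeD// good.
    - by rewrite -subset0 => z [/sqE[/= ? ? ? ?] /sqE[/= ? ? ? ?]]; lra.
    - by rewrite -subset0 => z [/sqE[/= ? ? ? ?] /sqE[/= ? ? ? ?]]; lra.
  have mU : measurable ((X1 `|` X2) `|` (X3 `|` X4) : set (plane R)).
    by apply: measurableU; apply: measurableU; exact: mS.
  rewrite -measureU; [|by apply: measurableU; exact: mS
    |by apply: measurableU; exact: mS|]; last first.
    rewrite -subset0 => z [h1 h2].
    by case: h1 => /sqE[? ? ? ?]; case: h2 => /sqE[? ? ? ?]; lra.
  apply: le_measure; rewrite ?inE; [exact: mU|exact: mS|].
  move=> z h; have {}h : exists b1 b2, [/\ a1 <= b1, b1 <= a1 + t, a2 <= b2, b2 <= a2 + t &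
      square (b1, b2) t z].
    by case: h => -[] h; [exists a1, a2|exists (a1 + t), a2|exists a1, (a2 + t)|
      exists (a1 + t), (a2 + t)]; split => //; lra.
  case: h => b1 [b2 [? ? ? ? /sqE[? ? ? ?]]]; split; rewrite /= in_itv /=; apply/andP; split; lra.
have [next nextP] := choice step.
pose x n := iter n next (a0, s0).
have xP n : [/\ 0 < (x n).2, bad (x n) & (x n).2 = s0 / (2 ^ n)%:R].
  elim: n => [|n [xn bn xE]]; first by split => //=; rewrite expn0 divr1.
  have [h1 h2 h3 h4] := nextP _ xn bn.
  split => //=; first by rewrite h2 divr_gt0.
  by rewrite h2 xE expnS natrM invfM mulrAC mulrA.
have xS n : [/\ (x n).1.1 <= (x n.+1).1.1 <= (x n).1.1 + (x n).2 / 2,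
    (x n).1.2 <= (x n.+1).1.2 <= (x n).1.2 + (x n).2 / 2 &
    (x n.+1).2 = (x n).2 / 2].
  by have [xn bn _] := xP n; have [_ -> -> ->] := nextP _ xn bn.
have lim (p : R * R -> R) : (forall n, p (x n).1 <= p (x n.+1).1 <= p (x n).1 + (x n).2 / 2) ->
    exists z : R, forall n, p (x n).1 <= z <= p (x n).1 + (x n).2.
  move=> pS.
  have nd n k : p (x n).1 <= p (x (n + k)%N).1.
    by elim: k => [|k IH]; rewrite ?addn0// addnS (le_trans IH)//; case/andP: (pS (n + k)%N).
  have ni n k : p (x (n + k)%N).1 + (x (n + k)%N).2 <= p (x n).1 + (x n).2.
    elim: k => [|k IH]; rewrite ?addn0// addnS (le_trans _ IH)//.
    have [_ _ ->] := xS (n + k)%N; case/andP: (pS (n + k)%N) => _ h; lra.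
  have cross n k : p (x n).1 <= p (x k).1 + (x k).2.
    have [nk|/ltnW kn] := leqP n k.
      apply: (le_trans (nd n (k - n)%N)); rewrite subnKC// lerDl.
      by have [/ltW] := xP k.
    apply: (le_trans _ (ni k (n - k)%N)); rewrite subnKC// lerDl.
    by have [/ltW] := xP n.
  exists (sup (range (fun n => p (x n).1))) => n; apply/andP; split.
    apply: ub_le_sup; last by exists n.
    by exists (p (x 0%N).1 + (x 0%N).2) => _ [k _ <-].
  by apply: ge_sup => [|_ [k _ <-]//]; exists (p (x 0%N).1), 0%N.
have [z1 z1P] := lim fst (fun n => let: And3 h _ _ := xS n in h).
have [z2 z2P] := lim snd (fun n => let: And3 _ h _ := xS n in h).
have zP n : closed_square (x n).1 (x n).2 (z1, z2).
  by split => /=; rewrite in_itv /= ?z1P ?z2P.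
have [M [d [uM d0 WM]]] := WP (z1, z2).
have [d' d'0 nuM] := nu_loc _ _ (zP 0%N) uM.
have [n xn] : exists n, (x n).2 < Num.min d d'.
  have D0 : 0 < Num.min d d' by rewrite lt_min d0.
  exists (Num.truncn (s0 / Num.min d d')).+1.
  have [_ _ ->] := xP (Num.truncn (s0 / Num.min d d')).+1.
  rewrite ltr_pdivrMr ?ltr0n ?expn_gt0// mulrC -ltr_pdivrMr//.
  by apply: lt_trans (truncnS_gt _) _; rewrite ltr_nat ltn_expl.
have [xn0 + _] := xP n; apply/negP; rewrite -leNgt.
move: xn; rewrite lt_min => /andP[xd xd'].
apply: le_trans (nuM _ _ _ (zP n)) _; first by rewrite xn0.
rewrite EFinM -(area_square (x n).1 (ltW xn0)); apply: WM => //.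
  exact: measurable_square.
move: (z1P n) (z2P n) => /andP[h1 h2] /andP[h3 h4] w [/=].
rewrite !in_itv /= => /andP[w1 w2] /andP[w3 w4].
split; rewrite /ball /= /ball_ ltr_norml; apply/andP; split; lra.
Qed.

End squares.

(** * Change of variables as an inequality *)

Section density_domination.
Context d d' (X : measurableType d) (Y : measurableType d') (R : realType).
Variables (m : {measure set X -> \bar R}) (n : {measure set Y -> \bar R}).
Variables (V : set X) (f : X -> Y) (k : Y -> \bar R).
Hypotheses (mV : measurable V) (mf : measurable_fun setT f).
Hypotheses (mk : measurable_fun setT k) (k0 : forall y, (0 <= k y)%E).
Hypothesis mnk : forall B, measurable B -> (m (V `&` f @^-1` B) <= \int[n]_(y in B) k y)%E.

Import HBNNSimple.

Let simple_domination (h : {nnsfun Y >-> R}) :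
  (\int[m]_(x in V) (h (f x))%:E <= \int[n]_y ((h y)%:E * k y))%E.
Proof.
have mh r : measurable (h @^-1` [set r]) by exact: measurable_funPTI.
have mI r : measurable_fun setT (fun y => (r * \1_(h @^-1` [set r]) y)%:E).
  by apply/measurable_EFinP; apply: measurable_funM => //; exact: measurable_indic.
have -> : (\int[m]_(x in V) (h (f x))%:E =
    \sum_(r \in range h) (r%:E * m (V `&` f @^-1` (h @^-1` [set r]))))%E.
  transitivity (\int[m]_(x in V)
      (\sum_(r \in range h) (r * \1_(h @^-1` [set r]) (f x))%:E))%E.
    by apply: eq_integral => x _; rewrite fimfunE fsumEFin.
  rewrite ge0_integral_fsum//; last 2 first.
  - by move=> r; apply: measurable_funTS; apply: (measurableT_comp (mI r)).
  - by move=> r x _; exact: nnfun_muleindic_ge0.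
  apply: eq_fsbigr => r; rewrite inE => -[y _ hy].
  have mfh : measurable (f @^-1` (h @^-1` [set r])) by rewrite -[X in measurable X]setTI; exact: mf.
  under eq_integral do rewrite EFinM.
  rewrite ge0_integralZl//.
  - rewrite setIC -integral_indic//.
  - by apply/measurable_EFinP/measurable_funTS; apply: (measurableT_comp _ mf);
    exact: measurable_indic.
  - by rewrite lee_fin -hy.
have -> : (\int[n]_y ((h y)%:E * k y) =
    \sum_(r \in range h) (r%:E * \int[n]_(y in h @^-1` [set r]) k y))%E.
  transitivity (\int[n]_y
      (\sum_(r \in range h) ((r * \1_(h @^-1` [set r]) y)%:E * k y)))%E.
    apply: eq_integral => y _; rewrite -ge0_mule_fsuml => [|r]; last exact: nnfun_muleindic_ge0.
    by rewrite fsumEFin// -fimfunE.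
  rewrite ge0_integral_fsum//; last 2 first.
  - by move=> r; exact: emeasurable_funM.
  - by move=> r y _; rewrite mule_ge0// nnfun_muleindic_ge0.
  apply: eq_fsbigr => r; rewrite inE => -[y _ hy].
  under eq_integral do rewrite EFinM -muleA.
  rewrite ge0_integralZl//; last 3 first.
  - by apply: emeasurable_funM => //; apply/measurable_EFinP; exact: measurable_indic.
  - by move=> z _; rewrite mule_ge0// lee_fin.
  - by rewrite lee_fin -hy.
  congr (_ * _)%E; rewrite [RHS]integral_mkcond; apply: eq_integral => z _.
  by rewrite epatch_indic muleC.
apply: lee_fsum => // r [y _ <-]; apply: lee_wpmul2l; first by rewrite lee_fin.
exact: mnk.
Qed.

(** The inequality for indicators extends to simple functions by linearity, then to
    all nonnegative functions by monotone convergence. *)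
Lemma density_domination (H : Y -> \bar R) :
  measurable_fun setT H -> (forall y, (0 <= H y)%E) ->
  (\int[m]_(x in V) H (f x) <= \int[n]_y (H y * k y))%E.
Proof.
move=> mH H0; pose h := nnsfun_approx measurableT mH.
have hnd a b : (a <= b)%N -> forall y, h a y <= h b y by move=> ab y; exact/lefP/nd_nnsfun_approx.
have -> : (\int[m]_(x in V) H (f x) = limn (fun j => \int[m]_(x in V) (h j (f x))%:E))%E.
  rewrite -monotone_convergence//.
  - by apply: eq_integral => x _; apply/esym/cvg_lim => //; exact: cvg_nnsfun_approx.
  - move=> j; apply: measurable_funTS; apply/measurable_EFinP.
    exact: measurableT_comp.
  - by move=> j x _; rewrite lee_fin.
  - by move=> x _ a b ab; rewrite lee_fin hnd.
apply: lime_le.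
  apply: ereal_nondecreasing_is_cvgn => a b ab; apply: ge0_le_integral => //.
  - by move=> x _; rewrite lee_fin.
  - by apply: measurable_funTS; apply/measurable_EFinP; exact: measurableT_comp.
  - by apply: measurable_funTS; apply/measurable_EFinP; exact: measurableT_comp.
  - by move=> x _; rewrite lee_fin hnd.
near=> j; apply: (le_trans (simple_domination (h j))).
apply: ge0_le_integral => //.
- by move=> y _; rewrite mule_ge0// lee_fin.
- by apply: emeasurable_funM => //; exact/measurable_EFinP.
- exact: emeasurable_funM.
move=> y _; apply: lee_wpmul2r => //.
have hH := @cvg_nnsfun_approx _ _ _ _ measurableT _ mH (fun y _ => H0 y) y I.
have nd : nondecreasing_seq (fun i => (h i y)%:E) by move=> a b ab; rewrite lee_fin hnd.
rewrite -(cvg_lim _ hH)// (cvg_lim _ (ereal_nondecreasing_cvgn nd))//.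
by apply: ereal_sup_ubound; exists j.
Unshelve. all: by end_near. Qed.

End density_domination.

Section change_of_variables.
Context {R : realType}.
Local Notation mu := (@lebesgue_measure R \x @lebesgue_measure R)%E.
Implicit Types (U V B E K : set (R * R)) (z : R * R).

(** [lam] dominates the pointwise Lipschitz constant of [chi] in the sup norm, the
    norm whose balls are squares.  Asking the bound for each [L > lam z] instead of
    [lam z] itself makes the modulus of a derivative admissible. *)
Definition lipschitz_bound U (chi : R * R -> R * R) (lam : R * R -> R) :=
  forall z (L : R), U z -> lam z < L -> exists2 d : R, 0 < d &
    forall z' (s : R), U z' -> 0 < s < d ->
      `|z'.1 - z.1| <= s -> `|z'.2 - z.2| <= s ->
      `|(chi z').1 - (chi z).1| <= L * s /\ `|(chi z').2 - (chi z).2| <= L * s.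

Lemma measure_square_subdivision (m : {measure set (plane R) -> \bar R}) (a : R * R) (s : R) :
  (m (square a s) <=
     m (square a (s / 2)%R) + m (square (a.1 + s / 2, a.2)%R (s / 2)%R) +
     (m (square (a.1, a.2 + s / 2)%R (s / 2)%R) +
      m (square (a.1 + s / 2, a.2 + s / 2)%R (s / 2)%R)))%E.
Proof.
have mS := @measurable_square R.
have mSU b c t : measurable (square b t `|` square c t : set (plane R)).
  by apply: measurableU; exact: mS.
apply: (@le_trans _ _ (m ((square a (s / 2) `|` square (a.1 + s / 2, a.2) (s / 2)) `|`
   (square (a.1, a.2 + s / 2) (s / 2) `|` square (a.1 + s / 2, a.2 + s / 2) (s / 2))))).
  apply: le_measure; rewrite ?inE; [exact: mS|by apply: measurableU; exact: mSU|].
  move=> z [/=]; rewrite !in_itv /= => /andP[h1 h2] /andP[h3 h4].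
  by have [h5|h5] := ltP z.1 (a.1 + s / 2); have [h6|h6] := ltP z.2 (a.2 + s / 2);
    [left; left|right; left|left; right|right; right]; split;
    rewrite /= in_itv /=; apply/andP; split; lra.
apply: (le_trans (measureU2 _ _ _)); try exact: mSU.
by apply: leeD; apply: measureU2; exact: mS.
Qed.

(** [chi] maps part of [U] onto [V], and [kappa] is its inverse on [V].  Images of
    sets by [chi] are written as preimages by [kappa], which are measurable. *)
Variables (U V : set (R * R)) (chi kappa : R * R -> R * R) (lam : R * R -> R).
Hypotheses (mU : measurable (U : set (plane R))) (mV : measurable (V : set (plane R))).
Hypothesis mkappa : measurable_fun setT (kappa : plane R -> plane R).
Hypothesis kappaV : forall w, V w -> U (kappa w) /\ chi (kappa w) = w.
Hypothesis mlam : measurable_fun setT (lam : plane R -> R).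
Hypothesis lam0 : forall z, 0 <= lam z.
Hypothesis chi_lip : lipschitz_bound U chi lam.

Let mpre E B : measurable (E : set (plane R)) -> measurable (B : set (plane R)) ->
  measurable (E `&` kappa @^-1` B : set (plane R)).
Proof.
move=> mE mB; apply: measurableI => //.
by rewrite -[X in measurable X]setTI; exact: mkappa.
Qed.

Let u z := 4 * lam z ^+ 2.

Let mu_ : measurable_fun setT (u : plane R -> R).
Proof. by apply: measurable_funM => //; exact: measurable_funX. Qed.

Let u0 z : 0 <= u z. Proof. by rewrite mulr_ge0// exprn_ge0. Qed.

(** The image of a square of side [t] around [z] lies in a square of side [2 L t],
    where [lam z < L]; hence the density [4 * lam z ^+ 2]. *)
Let image_square z M : U z -> u z < M ->
  exists2 d, 0 < d & forall a s, 0 < s < d -> closed_square a s z ->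
   (mu (V `&` kappa @^-1` square a s) <= (M * s ^+ 2)%:E)%E.
Proof.
move=> Uz uM.
have M0 : 0 < M by exact: le_lt_trans uM.
pose L := Num.sqrt M / 2.
have L0 : 0 < L by rewrite divr_gt0// sqrtr_gt0.
have LM : 4 * L ^+ 2 = M by rewrite /L expr_div_n sqr_sqrtr ?ltW//; field.
have lamL : lam z < L.
  by move: uM; rewrite -LM /u ltr_pM2l// ltr_pXn2r// ?nnegrE// ltW.
pose L1 := (lam z + L) / 2.
have [lamL1 L1L] : lam z < L1 /\ L1 < L by rewrite /L1; split; lra.
have [d d0 dP] := chi_lip Uz lamL1.
exists d => // b t /andP[t0 td] [/= zb1 zb2].
move: zb1 zb2; rewrite !in_itv /= => /andP[? ?] /andP[? ?].
pose c : R * R := ((chi z).1 - L * t, (chi z).2 - L * t).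
apply: (@le_trans _ _ (mu (square c (2 * L * t)))).
  apply: le_measure; rewrite ?inE.
  - by apply: mpre => //; exact: measurable_square.
  - exact: measurable_square.
  move=> w [Vw [/=]]; rewrite !in_itv /= => /andP[? ?] /andP[? ?].
  have [Uw wE] := kappaV Vw.
  have [] := dP (kappa w) t Uw _ _ _; rewrite ?t0// ?ler_norml.
  - by apply/andP; split; lra.
  - by apply/andP; split; lra.
  have LT : L1 * t < L * t by rewrite ltr_pM2r.
  rewrite wE => /andP[? ?] /andP[? ?].
  by split; rewrite /= in_itv /=; apply/andP; split; lra.
rewrite area_square; last by rewrite !mulr_ge0// ltW.
by rewrite lee_fin -LM !exprMn -!natrX.
Qed.

(** The density on [K] is [u], and it is zero off [K] because the complement of [K]
    is open: small squares around such points miss [K].  This is why [K] is closed;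
    for a general set, no such control holds at points of the complement. *)
Let image_compact (E K : set (R * R)) (a : R * R) (s : R) :
  measurable (E : set (plane R)) -> E `<=` V -> closed K -> K `<=` U -> 0 < s ->
  (mu (E `&` kappa @^-1` (K `&` square a s)) <= \int[mu]_(z in K) (u z)%:E)%E.
Proof.
move=> mE EV cK KU s0.
have mK := closed_measurable_plane cK.
pose m1 : {measure set (plane R) -> \bar R} := mrestr mu mE.
pose m2 : {measure set (plane R) -> \bar R} :=
  measure_function_pushforward__canonical__measure_function_Measure m1 mkappa.
pose m3 : {measure set (plane R) -> \bar R} := mrestr m2 mK.
have m3E S : m3 S = mu (E `&` kappa @^-1` (K `&` S)).
  rewrite -[LHS]/(mu (_ `&` _)) setIC; congr (mu (_ `&` _)).
  by rewrite -preimage_setI setIC.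
rewrite -m3E integral_mkcond.
have mS := @measurable_square R.
pose uK z := u z * \1_K z.
apply: (@le_trans _ _ (\int[mu]_(z in square a s) (uK z)%:E)%E).
  apply: (@square_majorization _ (fun b t => m3 (square b t))) => //.
  - by apply: measurable_funM => //; exact: measurable_indic.
  - by move=> z; rewrite mulr_ge0.
  - by move=> b t _; exact: measure_square_subdivision.
  - move=> z M _ uM; have [Kz|nKz] := pselect (K z).
      have [|d d0 dP] := image_square (KU _ Kz) (M := M).
        by move: uM; rewrite /uK indicE mem_set// mulr1.
      exists d => // b t td zb; apply: le_trans (dP b t td zb).
      rewrite m3E; apply: le_measure; rewrite ?inE.
      + by apply: mpre => //; apply: measurableI => //; exact: mS.
      + by apply: mpre => //; exact: mS.
      + by move=> w [Ew [_ Sw]]; split => //; exact: EV.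
    have : nbhs z (~` K) by apply: open_nbhs_nbhs; split => //; exact: closed_openC.
    move=> /nbhs_ballP[d /= d0 dK]; exists d => // b t /andP[t0 td] [/= zb1 zb2].
    have M0 : 0 <= M by apply: ltW; apply: le_lt_trans uM; rewrite /uK mulr_ge0.
    rewrite m3E (_ : K `&` _ = set0).
      by rewrite preimage_set0 setI0 measure0 lee_fin mulr_ge0// exprn_ge0// ltW.
    rewrite -subset0 => w [Kw [/=]]; move: zb1 zb2; rewrite !in_itv /=.
    move=> /andP[? ?] /andP[? ?] /andP[? ?] /andP[? ?].
    by apply: (dK w) => //; split; rewrite /ball /= /ball_ ltr_norml; apply/andP; split; lra.
apply: (@le_trans _ _ (\int[mu]_z (uK z)%:E)%E).
  apply: (ge0_subset_integral _ (mS a s) measurableT) => //.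
    by apply/measurable_EFinP; apply: measurable_funM => //; exact: measurable_indic.
  by move=> z _; rewrite lee_fin mulr_ge0.
rewrite le_eqVlt; apply/orP; left; apply/eqP; apply: eq_integral => z _.
by rewrite /uK epatch_indic EFinM.
Qed.

Let box (j : nat) : set (R * R) := square (- j%:R, - j%:R) (2 * j%:R).

Let box_ex z : exists j, box j z.
Proof.
exists (Num.truncn (Num.max `|z.1| `|z.2|)).+1.
have := truncnS_gt (Num.max `|z.1| `|z.2|); set j := _.+1.
rewrite gt_max !ltr_norml => /andP[/andP[? ?] /andP[? ?]].
by split; rewrite /= in_itv /=; apply/andP; split; lra.
Qed.

Let box_nd : {homo box : i j / (i <= j)%N >-> (i <= j)%O}.
Proof.
move=> i j; rewrite -(ler_nat R) => ij; apply/subsetPset => z [/=].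
rewrite !in_itv /= => /andP[? ?] /andP[? ?].
by split; rewrite /= in_itv /=; apply/andP; split; lra.
Qed.

(** Inner regularity of the measure pushed forward by [kappa] reduces to closed
    sets; intersecting with the boxes makes that measure finite. *)
Lemma image_measure_le B : measurable (B : set (plane R)) ->
  (mu (V `&` kappa @^-1` B) <= \int[mu]_(z in B) (4 * lam z ^+ 2 * \1_U z)%:E)%E.
Proof.
move=> mB.
have mS := @measurable_square R.
have mUu : measurable_fun setT (fun z : plane R => (4 * lam z ^+ 2 * \1_U z)%:E).
  by apply/measurable_EFinP; apply: measurable_funM => //; exact: measurable_indic.
pose F j := (V `&` box j) `&` kappa @^-1` (B `&` box j).
have mF j : measurable (F j : set (plane R)).
  by apply: mpre; apply: measurableI => //; exact: mS.
have UF : V `&` kappa @^-1` B = \bigcup_j F j.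
  apply/seteqP; split => [w [Vw Bw]|w [j _ [[Vw _] [Bw _]]]//].
  have [i iw] := box_ex w; have [j jw] := box_ex (kappa w).
  exists (maxn i j) => //; split; split => //.
    by apply: (subsetPset _ _ (box_nd (leq_maxl i j))).
  by apply: (subsetPset _ _ (box_nd (leq_maxr i j))).
have : (mu \o F) j @[j --> \oo] --> mu (V `&` kappa @^-1` B).
  rewrite UF; apply: nondecreasing_cvg_mu => //; first exact: bigcupT_measurable.
  move=> i j ij; apply/subsetPset => w [[Vw wi] [Bw ki]].
  have /subsetPset bij := box_nd ij.
  by split; split => //; exact: bij.
move/cvg_lim => <- //; apply: lime_le.
  apply: ereal_nondecreasing_is_cvgn => i j ij; apply: le_measure; rewrite ?inE//.
  move=> w [[Vw wi] [Bw ki]]; have /subsetPset bij := box_nd ij.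
  by split; split => //; exact: bij.
near=> j.
apply/lee_addgt0Pr => e e0.
have mE : measurable (V `&` box j : set (plane R)) by apply: measurableI => //; exact: mS.
pose m1 : {measure set (plane R) -> \bar R} := mrestr mu mE.
pose m2 : {measure set (plane R) -> \bar R} :=
  measure_function_pushforward__canonical__measure_function_Measure m1 mkappa.
have m2E S : m2 S = mu ((V `&` box j) `&` kappa @^-1` S).
  by rewrite -[LHS]/(mu (_ `&` _)) setIC.
have m2fin : (m2 setT < +oo)%E.
  rewrite m2E preimage_setT setIT; apply: (@le_lt_trans _ _ (mu (box j))).
    by apply: le_measure; rewrite ?inE; [exact: mE|exact: mS|exact: subIsetr].
  by rewrite area_square ?ltry// mulr_ge0.
have mBU : measurable (B `&` U : set (plane R)) by exact: measurableI.
have [K [G [cK oG KB BG GK]]] := finite_measure_regular m2fin mBU e0.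
have mK := closed_measurable_plane cK; have mG := open_measurable_plane oG.
have j0 : 0 < 2 * j%:R :> R by rewrite mulr_gt0// ltr0n; near: j; exists 1%N.
have := @image_compact (V `&` box j) K (- j%:R, - j%:R) (2 * j%:R) mE
  (@subIsetl _ _ _) cK (fun z Kz => (KB z Kz).2) j0.
rewrite -/(box j) => HK.
apply: (@le_trans _ _ (mu ((V `&` box j) `&` kappa @^-1` (K `&` box j)) + m2 (G `\` K))%E).
  rewrite m2E.
  have mGK : measurable (G `\` K : set (plane R)) by exact: measurableD.
  apply: le_trans (measureU2 _ _ _).
  - apply: le_measure; rewrite ?inE//.
      by apply: measurableU; apply: mpre => //; apply: measurableI => //; exact: mS.
    move=> w [[Vw wj] [Bw kj]].
    have [Kw|nKw] := pselect (K (kappa w)); [left|right]; split => //.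
    split => //; apply: BG; split => //; exact: (kappaV Vw).1.
  - by apply: mpre => //; apply: measurableI => //; exact: mS.
  - by apply: mpre.
apply: leeD; last exact: ltW.
apply: (le_trans HK).
apply: (@le_trans _ _ (\int[mu]_(z in K) (4 * lam z ^+ 2 * \1_U z)%:E)%E).
  rewrite le_eqVlt; apply/orP; left; apply/eqP; apply: eq_integral => z; rewrite inE => Kz.
  by rewrite indicE mem_set ?mulr1//; exact: (KB z Kz).2.
apply: ge0_subset_integral => //.
- exact: measurable_funTS.
- by move=> z _; rewrite lee_fin mulr_ge0//; exact: u0.
- by move=> z /KB[].
Unshelve. all: by end_near. Qed.

Lemma integral_comp_le (H : R * R -> R) :
  measurable_fun setT (H : plane R -> R) -> (forall z, 0 <= H z) ->
  (\int[mu]_(w in V) (H (kappa w))%:E <=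
   \int[mu]_(z in U) (H z * (4 * lam z ^+ 2))%:E)%E.
Proof.
move=> mH H0.
have mUu : measurable_fun setT (fun z : plane R => (4 * lam z ^+ 2 * \1_U z)%:E).
  by apply/measurable_EFinP; apply: measurable_funM => //; exact: measurable_indic.
have mEH : measurable_fun setT (fun z : plane R => (H z)%:E) by exact/measurable_EFinP.
have k0 (z : plane R) : (0 <= (4 * lam z ^+ 2 * \1_U z)%:E)%E.
  by rewrite lee_fin mulr_ge0//; exact: u0.
have HE0 (z : plane R) : (0 <= (H z)%:E)%E by rewrite lee_fin.
apply: (le_trans (density_domination mV mkappa mUu k0 image_measure_le mEH HE0)).
rewrite [leRHS]integral_mkcond le_eqVlt; apply/orP; left; apply/eqP.
apply: eq_integral => z _.
by rewrite epatch_indic -!EFinM; congr EFin; exact: mulrA.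
Qed.

End change_of_variables.

(** * Planar Sobolev inequality for upper slopes *)

Section hoelder_integral.
Context d (T : measurableType d) (R : realType).
Variable m : {measure set T -> \bar R}.

Lemma hoelder_integral (f g : T -> R) (p q : R) :
  measurable_fun setT f -> measurable_fun setT g ->
  (forall x, 0 <= f x) -> (forall x, 0 <= g x) ->
  0 < p -> 0 < q -> p^-1 + q^-1 = 1 ->
  (\int[m]_x (f x * g x)%:E <=
   (\int[m]_x (f x `^ p)%:E) `^ p^-1 * (\int[m]_x (g x `^ q)%:E) `^ q^-1)%E.
Proof.
move=> mf mg f0 g0 p0 q0 pq.
have := hoelder m mf mg p0 q0 pq.
rewrite Lnorm1 unlock /=.
have -> : (\int[m]_x `|(f x * g x)%:E| = \int[m]_x (f x * g x)%:E)%E.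
  by apply: eq_integral => x _; rewrite gee0_abs// lee_fin mulr_ge0.
have E (k : T -> R) (r : R) : (forall x, 0 <= k x) ->
    (\int[m]_x (`|(k x)%:E| `^ r) = \int[m]_x (k x `^ r)%:E)%E.
  by move=> k0; apply: eq_integral => x _; rewrite gee0_abs ?poweR_EFin// lee_fin.
by rewrite !E.
Qed.

End hoelder_integral.

Section slopes.
Context {R : realType}.
Local Notation mu := (@lebesgue_measure R \x @lebesgue_measure R)%E.
Implicit Types (z : R * R) (g v u w : R * R -> R).

(** An upper gradient in the sup norm, stated as for [lipschitz_bound]. *)
Definition upper_slope v u :=
  forall z (M : R), u z < M -> exists2 d : R, 0 < d &
    forall z' (s : R), 0 < s < d ->
      `|z'.1 - z.1| <= s -> `|z'.2 - z.2| <= s -> `|v z' - v z| <= M * s.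

Lemma mul_lt_split (a b M : R) : 0 <= a -> 0 <= b -> a * b < M ->
  exists a' b', [/\ a < a', b < b' & a' * b' = M].
Proof.
move=> a0 b0 abM; have M0 : 0 < M by apply: le_lt_trans abM; rewrite mulr_ge0.
pose e := (M - a * b) / (a + b + 1 + M).
have D0 : 0 < a + b + 1 + M by lra.
have e0 : 0 < e by rewrite divr_gt0// subr_gt0.
have e1 : e < 1 by rewrite ltr_pdivrMr//; nra.
have h : (a + e) * (b + e) < M.
  have : e * (a + b + 1 + M) = M - a * b by rewrite /e divfK// gt_eqF.
  by nra.
exists (a + e), (M / (a + e)); have ae : 0 < a + e by lra.
split; first lra.
  by rewrite ltr_pdivlMr//; nra.
by rewrite mulrC divfK// gt_eqF.
Qed.

(** The tangent line at the larger point [x] lies below the convex function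
    [t `^ g0]; that inequality is Young's for [x `^ (g0 - 1)] and [y]. *)
Lemma powR_slope (g0 x y c : R) : 1 < g0 -> 0 <= x -> 0 <= y -> x <= c -> y <= c ->
  `|x `^ g0 - y `^ g0| <= g0 * c `^ (g0 - 1) * `|x - y|.
Proof.
move=> g1; wlog xy : x y / y <= x => [hw|].
  have [yx|/ltW xy] := leP y x; first exact: hw.
  by move=> x0 y0 xc yc; rewrite distrC [`|x - y|]distrC; exact: hw.
move=> x0 y0 xc yc.
have g00 : 0 < g0 by apply: lt_trans g1.
rewrite ger0_norm; last by rewrite subr_ge0 ge0_ler_powR// ltW.
rewrite ger0_norm ?subr_ge0//.
have g10 : 0 < g0 - 1 by rewrite subr_gt0.
have conj : (g0 / (g0 - 1))^-1 + g0^-1 = 1.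
  by rewrite invf_div; field; rewrite gt_eqF.
have := @conjugate_powR _ (x `^ (g0 - 1)) y (g0 / (g0 - 1)) g0
  (powR_ge0 _ _) y0 (divr_gt0 g00 g10) g00 conj.
rewrite -powRrM.
have -> : (g0 - 1) * (g0 / (g0 - 1)) = g0 by rewrite mulrC divfK// gt_eqF.
have xE : x `^ g0 = x * x `^ (g0 - 1) by rewrite mulr_powRB1.
have cE : x `^ (g0 - 1) <= c `^ (g0 - 1).
  by rewrite ge0_ler_powR// ?nnegrE// ?(ltW g10)//; exact: le_trans xc.
set X := x `^ (g0 - 1) in xE cE *; rewrite -(ler_pM2l g00) => H.
have {}H : g0 * (X * y) <= x `^ g0 * (g0 - 1) + y `^ g0.
  apply: (le_trans H); rewrite le_eqVlt; apply/orP; left; apply/eqP.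
  by field; rewrite !gt_eqF.
apply: (@le_trans _ _ (g0 * X * (x - y))).
  have : g0 * X * (x - y) = g0 * x `^ g0 - g0 * (X * y) by rewrite xE; ring.
  lra.
by apply: ler_wpM2r; [rewrite subr_ge0|rewrite ler_pM2l].
Qed.

(** By [powR_slope] with a bound [c] slightly above [`|g z|]; the room below [M] is shared
    between [c] and the slope of [g] by [mul_lt_split]. *)
Lemma upper_slope_powR g w (g0 : R) : 1 < g0 -> (forall z, 0 <= w z) ->
  upper_slope g w ->
  upper_slope (fun z => `|g z| `^ g0) (fun z => g0 * `|g z| `^ (g0 - 1) * w z).
Proof.
move=> g1 w0 gw z M hM.
have g00 : 0 < g0 by apply: lt_trans g1.
have g10 : 0 < g0 - 1 by rewrite subr_gt0.
have [a [b [ha hb abM]]] := mul_lt_split (mulr_ge0 (ltW g00) (powR_ge0 _ _)) (w0 z) hM.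
have a0 : 0 < a by apply: le_lt_trans ha; rewrite mulr_ge0 ?powR_ge0// ltW.
(* [c] is the value at which the factor [g0 * c `^ (g0 - 1)] reaches [a]; it exceeds
   [`|g z|], so [`|g|] stays below it near [z] *)
pose c := (a / g0) `^ (g0 - 1)^-1.
have cE : g0 * c `^ (g0 - 1) = a.
  rewrite /c -powRrM mulVf ?gt_eqF// powRr1 ?divr_ge0// ?ltW//.
  by rewrite mulrC divfK// gt_eqF.
have gc : `|g z| < c.
  rewrite ltNge; apply/negP => cg; move: ha; rewrite -cE ltr_pM2l// ltNge => /negP; apply.
  by rewrite ge0_ler_powR// ?nnegrE// ?powR_ge0// ltW.
have b0 : 0 < b by exact: le_lt_trans hb.
have [d d0 dP] := gw z b hb.
have e0 : 0 < (c - `|g z|) / b by rewrite divr_gt0// subr_gt0.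
exists (Num.min d ((c - `|g z|) / b)); first by rewrite lt_min d0.
move=> z' s; rewrite lt_min => /and3P[s0 sd sc] h1 h2.
have {}dP := dP z' s; rewrite s0 sd in dP; have {dP}Hg := dP isT h1 h2.
have Hs : b * s < c - `|g z| by rewrite mulrC -ltr_pdivlMr.
have Hn : `| `|g z'| - `|g z| | <= `|g z' - g z| by exact: ler_dist_dist.
have gc' : `|g z'| <= c by have := ler_norm (`|g z'| - `|g z|); lra.
apply: (le_trans (powR_slope g1 (normr_ge0 _) (normr_ge0 _) gc' (ltW gc))).
rewrite cE -abM -mulrA ler_pM2l//.
exact: le_trans Hn Hg.
Qed.

(** The total increment is bounded by the integral of the slope, with no regularity
    of [u] beyond measurability: [square_majorization] is applied to the increment of
    [h] along the base of a square times its side, and the second coordinate is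
    integrated out. *)
Lemma upper_slope_line (h u : R -> R) (a s : R) : 0 < s ->
  measurable_fun setT (u : measurableTypeR R -> R) -> (forall x, 0 <= u x) ->
  (forall x M, u x < M -> exists2 d : R, 0 < d &
     forall y t, 0 < t < d -> `|y - x| <= t -> `|h y - h x| <= M * t) ->
  (`|h (a + s) - h a|%:E <= \int[@lebesgue_measure R]_x (u x)%:E)%E.
Proof.
move=> s0 mu_ u0 hu.
have mf : measurable_fun setT (fun z : plane R => u z.1).
  by apply: (measurableT_comp mu_); exact: measurable_fst.
have := @square_majorization _ (fun b t => (`|h (b.1 + t) - h b.1| * t)%:E)
  (fun z => u z.1) (a, 0) s s0 mf (fun z => u0 z.1).
have loc x M : u x < M -> exists2 d : R, 0 < d & forall y, `|y - x| < d ->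
    `|h y - h x| <= M * `|y - x|.
  move=> uM; have [d d0 dP] := hu _ _ uM; exists d => // y yd.
  have [->|yx] := eqVneq y x; first by rewrite !subrr normr0 mulr0.
  by apply: dP; rewrite // yd andbT normr_gt0 subr_eq0.
move=> /(_ _ _)H.
have {H} : ((`|h (a + s) - h a| * s)%:E <=
    \int[mu]_(z in square (a, 0%R) s) (u z.1)%:E)%E.
  apply: H.
  - move=> b t t0 /=; rewrite -!EFinD lee_fin.
    have -> : b.1 + t / 2 + t / 2 = b.1 + t by field.
    set p := b.1 + t / 2.
    have := ler_distD (h p) (h (b.1 + t)) (h b.1); nra.
  - move=> z M _ uM; have [d d0 dP] := loc _ _ uM.
    exists d => // b t /andP[t0 td] [/= + _]; rewrite in_itv /= => /andP[h1 h2].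
    rewrite lee_fin expr2 mulrA ler_pM2r//.
    have H1 : `|b.1 + t - z.1| = b.1 + t - z.1 by rewrite ger0_norm// subr_ge0.
    have H2 : `|b.1 - z.1| = z.1 - b.1 by rewrite distrC ger0_norm// subr_ge0.
    have := dP (b.1 + t); have := dP b.1; rewrite H1 H2 => /(_ _)K1 /(_ _)K2.
    have {}K1 : `|h b.1 - h z.1| <= M * (z.1 - b.1) by apply: K1; lra.
    have {}K2 : `|h (b.1 + t) - h z.1| <= M * (b.1 + t - z.1) by apply: K2; lra.
    have := ler_distD (h z.1) (h (b.1 + t)) (h b.1).
    by rewrite [`|h z.1 - _|]distrC; lra.
pose B : set (measurableTypeR R) := `[0, 0 + s[%classic.
have mB : measurable B by exact: measurable_itv.
have mfB : measurable_fun setT (fun z : plane R => (u z.1 * \1_B z.2)%:E).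
  apply/measurable_EFinP; apply: measurable_funM => //.
  by apply: measurableT_comp; [exact: measurable_indic|exact: measurable_snd].
have fB0 (z : plane R) : (0 <= (u z.1 * \1_B z.2)%:E)%E by rewrite lee_fin mulr_ge0.
move=> H; have {H} : ((`|h (a + s) - h a| * s)%:E <=
    \int[mu]_z (u z.1 * \1_B z.2)%:E)%E.
  apply: (le_trans H); rewrite integral_mkcond; apply: ge0_le_integral => //.
  - by move=> z _; apply: erestrict_ge0 => y _; rewrite lee_fin.
  - apply/(measurable_restrictT _ (measurable_square _ _)).
    by apply/measurable_EFinP; exact: measurable_funTS.
  - move=> z _; rewrite patchE; case: ifPn => [|_]; last exact: fB0.
    by rewrite inE => -[_ zB]; rewrite indicE mem_set// mulr1.
rewrite fubini_tonelli1// /fubini_F.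
have -> : (\int[@lebesgue_measure R]_x \int[@lebesgue_measure R]_y (u x * \1_B y)%:E =
           \int[@lebesgue_measure R]_x ((u x)%:E * s%:E))%E.
  apply: eq_integral => x _; under eq_integral do rewrite EFinM.
  rewrite ge0_integralZl//; last 2 first.
  - by apply/measurable_EFinP; exact: measurable_indic.
  - by rewrite lee_fin.
  rewrite integral_indic// setIT; congr (_ * _)%E.
  rewrite [LHS](lebesgue_measure_itv `[0, 0 + s[) /= lte_fin ltrDl s0 -EFinB.
  by congr EFin; ring.
rewrite ge0_integralZr//;
  [|exact/measurable_EFinP|by move=> x _; rewrite lee_fin|by rewrite lee_fin ltW].
by rewrite EFinM lee_pmul2r.
Qed.

Lemma le_line_integral (h u : R -> R) (N x : R) :
  measurable_fun setT (u : measurableTypeR R -> R) -> (forall x, 0 <= u x) ->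
  (forall x M, u x < M -> exists2 d : R, 0 < d &
     forall y t, 0 < t < d -> `|y - x| <= t -> `|h y - h x| <= M * t) ->
  (forall x, N < `|x| -> h x = 0) ->
  (`|h x|%:E <= \int[@lebesgue_measure R]_t (u t)%:E)%E.
Proof.
move=> mu_ u0 hu hN.
have [xN|] := ltP N `|x|.
  by rewrite hN// normr0; apply: integral_ge0 => t _; rewrite lee_fin.
rewrite ler_norml => /andP[xN1 xN2].
pose a := - N - 1; have s0 : 0 < x - a by rewrite /a; lra.
have := upper_slope_line a s0 mu_ u0 hu.
rewrite subrKC (hN a) ?subr0//.
by rewrite /a ltr_normr; apply/orP; right; lra.
Qed.

(** Gagliardo's argument: [`|v (x, y)|] is at most the integral of [u] along the
    vertical line through [x] and at most that along the horizontal line through [y];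
    the product of the two bounds integrates to a product, by Tonelli. *)
Lemma sobolev_one v u (N : R) :
  measurable_fun setT (v : plane R -> R) -> measurable_fun setT (u : plane R -> R) ->
  (forall z, 0 <= u z) -> upper_slope v u ->
  (forall z, (N < `|z.1|) || (N < `|z.2|) -> v z = 0) ->
  (\int[mu]_z (v z ^+ 2)%:E <= \int[mu]_z (u z)%:E * \int[mu]_z (u z)%:E)%E.
Proof.
move=> mv mu_ u0 uv vN.
have mE : measurable_fun setT (fun z : plane R => (u z)%:E) by exact/measurable_EFinP.
have E0 (z : plane R) : (0 <= (u z)%:E)%E by rewrite lee_fin.
pose F x := (\int[@lebesgue_measure R]_y (u (x, y))%:E)%E.
pose G y := (\int[@lebesgue_measure R]_x (u (x, y))%:E)%E.
have mF : measurable_fun setT (F : measurableTypeR R -> \bar R).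
  exact: (measurable_fun_fubini_tonelli_F _ mE E0).
have mG : measurable_fun setT (G : measurableTypeR R -> \bar R).
  exact: (measurable_fun_fubini_tonelli_G _ mE E0).
have F0 x : (0 <= F x)%E by apply: integral_ge0 => y _; rewrite lee_fin.
have G0 y : (0 <= G y)%E by apply: integral_ge0 => x _; rewrite lee_fin.
have vF z : (`|v z|%:E <= F z.1)%E.
  case: z => x y; apply: (@le_line_integral (fun t => v (x, t)) (fun t => u (x, t)) N) => //.
  - by apply: (measurableT_comp mu_); exact: measurable_pair1.
  - move=> t M /uv[d d0 dP]; exists d => // t' s s0 tt'; apply: dP => //=.
    by rewrite subrr normr0; case/andP: s0 => /ltW.
  - by move=> t tN; rewrite vN//= tN orbT.
have vG z : (`|v z|%:E <= G z.2)%E.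
  case: z => x y; apply: (@le_line_integral (fun t => v (t, y)) (fun t => u (t, y)) N) => //.
  - by apply: (measurableT_comp mu_); exact: measurable_pair2.
  - move=> t M /uv[d d0 dP]; exists d => // t' s s0 tt'; apply: dP => //=.
    by rewrite subrr normr0; case/andP: s0 => /ltW.
  - by move=> t tN; rewrite vN//= tN.
have mFG : measurable_fun setT (fun z : plane R => (F z.1 * G z.2)%E).
  apply: emeasurable_funM; first exact: (measurableT_comp mF measurable_fst).
  exact: (measurableT_comp mG measurable_snd).
have FG0 (z : plane R) : (0 <= F z.1 * G z.2)%E by rewrite mule_ge0.
apply: (@le_trans _ _ (\int[mu]_z (F z.1 * G z.2))%E).
  apply: ge0_le_integral => //.
  - by move=> z _; rewrite lee_fin sqr_ge0.
  - by apply/measurable_EFinP; exact: measurable_funX.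
  - move=> z _; rewrite -real_normK ?num_real// expr2 EFinM.
    by apply: lee_pmul => //; rewrite lee_fin.
rewrite fubini_tonelli1// /fubini_F /=.
under eq_integral do rewrite ge0_integralZl//.
rewrite ge0_integralZr//; last by apply: integral_ge0.
by rewrite -(fubini_tonelli1 _ mE E0) -(fubini_tonelli2 _ mE E0).
Qed.

(** Here [A] is the integral of [`|g|] to the Sobolev exponent [2 c].  It occurs on
    both sides and is finite, so it can be divided out: what remains is the power
    [1 / 2 - (q - 1) / q = 1 / (2 c)]. *)
Lemma absorb_power (A W I : \bar R) (q : R) : let c := q / (2 - q) in
  1 < q < 2 -> (0 <= A < +oo)%E -> (0 <= W)%E -> (0 <= I)%E ->
  (A <= (c%:E * I) * (c%:E * I))%E -> (I <= A `^ ((q - 1) / q) * W `^ q^-1)%E ->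
  (A `^ (2 * c)^-1 <= c%:E * W `^ q^-1)%E.
Proof.
move=> c /andP[q1 q2] /andP[A0 Afin] W0 I0 H1; rewrite -invf_div.
set q' := q / (q - 1) => H2.
have q0 : 0 < q by lra.
have q20 : 0 < 2 - q by lra.
have c0 : 0 < c by rewrite divr_gt0.
have [Wfin|] := ltP W +oo%E; last first.
  rewrite leye_eq => /eqP ->; rewrite poweRyr ?invr_eq0 ?gt_eqF//.
  by rewrite gt0_muley ?lte_fin// leey.
have {H1} : (A <= (c%:E * (A `^ q'^-1 * W `^ q^-1)) * (c%:E * (A `^ q'^-1 * W `^ q^-1)))%E.
  have cI : (c%:E * I <= c%:E * (A `^ q'^-1 * W `^ q^-1))%E.
    by apply: lee_wpmul2l; rewrite ?lee_fin// ltW.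
  by apply: (le_trans H1); apply: lee_pmul => //; rewrite mule_ge0// lee_fin ltW.
have AE : A = (fine A)%:E by rewrite fineK// ge0_fin_numE.
have WE : W = (fine W)%:E by rewrite fineK// ge0_fin_numE.
rewrite AE WE !poweR_EFin -!EFinM !lee_fin.
have : 0 <= fine A by exact: fine_ge0.
set a := fine A; set b := (fine W `^ q^-1) => a0 H.
have b0 : 0 <= b by exact: powR_ge0.
have [->|an0] := eqVneq a 0.
  have -> : 0 `^ (2 * c)^-1 = 0 :> R by rewrite powR0// invr_eq0 gt_eqF// mulr_gt0.
  by rewrite mulr_ge0// ltW.
have {an0}a0 : 0 < a by rewrite lt_def an0.
have K0 : 0 < a `^ q'^-1 by exact: powR_gt0.
rewrite -(ler_pM2r K0) -powRD; last by rewrite (gt_eqF a0) implybT.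
have -> : (2 * c)^-1 + q'^-1 = 2^-1.
  by rewrite /c /q'; field; rewrite !gt_eqF//; lra.
rewrite powR12_sqrt ?(ltW a0)//.
have X0 : 0 <= c * b * a `^ q'^-1 by rewrite mulr_ge0 ?(ltW K0)// mulr_ge0// ltW.
rewrite -(ger0_norm X0) -sqrtr_sqr ler_sqrt; last exact: exprn_ge0.
apply: (le_trans H); rewrite le_eqVlt; apply/orP; left; apply/eqP; ring.
Qed.

(** Apply [sobolev_one] to the power [c = q / (2 - q)] of [`|g|], then Hoelder's
    inequality to the slope [c * `|g| `^ (c - 1) * w]: the conjugate exponent of [q]
    turns [`|g| `^ (c - 1)] into [`|g| `^ (2 c)], which [absorb_power] removes. *)
Lemma sobolev g w (N C q : R) : 1 < q < 2 ->
  measurable_fun setT (g : plane R -> R) -> measurable_fun setT (w : plane R -> R) ->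
  (forall z, 0 <= w z) -> upper_slope g w -> (forall z, `|g z| <= C) ->
  (forall z, (N < `|z.1|) || (N < `|z.2|) -> g z = 0) ->
  ((\int[mu]_z (`|g z| `^ (2 * q / (2 - q)))%:E) `^ (2 * q / (2 - q))^-1 <=
   (q / (2 - q))%:E * (\int[mu]_z (w z `^ q)%:E) `^ q^-1)%E.
Proof.
move=> /andP[q1 q2] mg mw w0 gw gC gN.
have q0 : 0 < q by lra.
have q20 : 0 < 2 - q by lra.
set c := q / (2 - q); have c1 : 1 < c by rewrite /c ltr_pdivlMr//; lra.
have c0 : 0 < c by lra.
have sE : 2 * q / (2 - q) = 2 * c by rewrite /c mulrA.
rewrite sE; set A := (\int[mu]_z _)%E; set W := (\int[mu]_z (w z `^ q)%:E)%E.
have mgn : measurable_fun setT (fun z : plane R => `|g z|) by exact: measurableT_comp.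
have mpow (e : R) : measurable_fun setT (fun z : plane R => `|g z| `^ e).
  exact: (measurableT_comp (measurable_powR e) mgn).
have A0 : (0 <= A)%E by apply: integral_ge0 => z _; rewrite lee_fin powR_ge0.
have W0 : (0 <= W)%E by apply: integral_ge0 => z _; rewrite lee_fin powR_ge0.
have Afin : (A < +oo)%E.
  pose Q := square (- `|N|, - `|N|) (2 * `|N| + 1).
  have mQ : measurable (Q : set (plane R)) := measurable_square _ _.
  have C0 : 0 <= C by exact: le_trans (gC (0, 0)).
  apply: (@le_lt_trans _ _ (\int[mu]_z ((C `^ (2 * c))%:E * (\1_Q z)%:E))%E).
    apply: ge0_le_integral => //.
    - exact/measurable_EFinP.
    - by apply: emeasurable_funM => //; apply/measurable_EFinP; exact: measurable_indic.
    - move=> z _; rewrite -EFinM lee_fin.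
      have [zN|] := boolP ((N < `|z.1|) || (N < `|z.2|)).
        by rewrite gN// normr0 powR0 ?mulr_ge0 ?powR_ge0// gt_eqF// mulr_gt0.
      rewrite negb_or -!leNgt => /andP[h1 h2].
      have h (x : R) : `|x| <= N -> - `|N| <= x < - `|N| + (2 * `|N| + 1).
        by move=> xN; have := ler_norm N; move: xN; rewrite ler_norml; lra.
      rewrite indicE mem_set ?mulr1; last by split; rewrite /= in_itv /=; apply: h.
      by rewrite ge0_ler_powR// mulr_ge0// ltW.
  rewrite ge0_integralZl//.
  - rewrite integral_indic// setIT (_ : _ Q = ((2 * `|N| + 1) ^+ 2)%:E) ?ltry//.
    by apply: area_square; have := normr_ge0 N; lra.
  - by apply/measurable_EFinP; exact: measurable_indic.
  - by rewrite lee_fin powR_ge0.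
pose I := (\int[mu]_z (`|g z| `^ (c - 1) * w z)%:E)%E.
have H1 : (A <= (c%:E * I) * (c%:E * I))%E.
  have IE : (c%:E * I = \int[mu]_z (c * `|g z| `^ (c - 1) * w z)%:E)%E.
    rewrite -ge0_integralZl//.
    - by apply: eq_integral => z _; rewrite -EFinM mulrA.
    - by apply/measurable_EFinP; exact: measurable_funM.
    - by move=> z _; rewrite lee_fin mulr_ge0// powR_ge0.
    - by rewrite lee_fin ltW.
  rewrite IE.
  have -> : A = (\int[mu]_z ((`|g z| `^ c) ^+ 2)%:E)%E.
    apply: eq_integral => z _; rewrite -powR_mulrn ?powR_ge0//.
    by rewrite -powRrM [2 * c]mulrC.
  apply: (@sobolev_one _ _ N) => //.
  - by apply: measurable_funM => //; apply: measurable_funM.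
  - by move=> z; rewrite mulr_ge0// mulr_ge0 ?powR_ge0// ltW.
  - exact: upper_slope_powR.
  - by move=> z zN; rewrite gN// normr0 powR0// gt_eqF.
pose q' := q / (q - 1).
have q'0 : 0 < q' by rewrite divr_gt0//; lra.
have qq' : q'^-1 + q^-1 = 1 by rewrite /q' invf_div; field; rewrite gt_eqF.
have H2 : (I <= A `^ q'^-1 * W `^ q^-1)%E.
  have -> : A = (\int[mu]_z ((`|g z| `^ (c - 1)) `^ q')%:E)%E.
    apply: eq_integral => z _; congr EFin.
    rewrite -powRrM; congr (_ `^ _).
    by rewrite /c /q'; field; rewrite !gt_eqF//; lra.
  exact: hoelder_integral (mpow (c - 1)) mw (fun z => powR_ge0 _ _) w0 q'0 q0 qq'.
have I0 : (0 <= I)%E by apply: integral_ge0 => z _; rewrite lee_fin mulr_ge0// powR_ge0.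
apply: (@absorb_power A W I q) => //; [by rewrite q1|by rewrite A0|].
by move: H2; rewrite /q' invf_div.
Qed.

End slopes.

(** * Complex differentiable maps and smooth functions in real coordinates *)

Section complex_plane.
Context {R : realType}.
Implicit Types (w z : R[i]) (x y : R) (O : set R[i]).

Definition cplx (p : R * R) : R[i] := p.1 +i* p.2.
Definition coords w : R * R := (complex.Re w, complex.Im w).

Lemma cplxK : cancel cplx coords. Proof. by case. Qed.
Lemma coordsK : cancel coords cplx. Proof. by case. Qed.

Lemma modulus_ge0 w : 0 <= modulus w.
Proof. by case: w => a b; rewrite modE sqrtr_ge0. Qed.

Lemma modulusD w z : modulus (w + z) <= modulus w + modulus z.
Proof. by rewrite -lecR rmorphD /= -!norm_modulus ler_normD. Qed.

Lemma modulusM w z : modulus (w * z) = modulus w * modulus z.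
Proof.
apply: (can_inj (fun x : R => erefl : complex.Re x%:C = x)).
by rewrite rmorphM /= -!norm_modulus normrM.
Qed.

Lemma modulusV w : modulus w^-1 = (modulus w)^-1.
Proof.
apply: (can_inj (fun x : R => erefl : complex.Re x%:C = x)).
by rewrite fmorphV /= -!norm_modulus normfV.
Qed.

Lemma modulusB w z : modulus (w - z) = modulus (z - w).
Proof. by rewrite /modulus distrC. Qed.

Lemma modulus0 : modulus (0 : R[i]) = 0.
Proof. by rewrite /modulus normr0. Qed.

Lemma modulus_gt0 w : (0 < modulus w) = (w != 0).
Proof. by rewrite -ltcR -norm_modulus normr_gt0. Qed.

Lemma modulus_le w : modulus w <= `|complex.Re w| + `|complex.Im w|.
Proof.
case: w => a b; rewrite modE /= -(ler_pXn2r (n := 2)) ?nnegrE ?addr_ge0 ?sqrtr_ge0//.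
rewrite sqr_sqrtr ?addr_ge0 ?sqr_ge0// sqrrD !real_normK ?num_real//.
by rewrite lerD2r lerDl mulrn_wge0// mulr_ge0.
Qed.

Lemma nbhs_modulusP z (A : set R[i]) :
  nbhs z A <-> exists2 d : R, 0 < d & forall w, modulus (w - z) < d -> A w.
Proof.
split => [/nbhs_ballP[d /= d0 dA]|[d d0 dA]].
  have dE : d = (complex.Re d)%:C.
    by case: d d0 {dA} => a b; rewrite ltcE /= => /andP[/eqP -> _].
  exists (complex.Re d); first by rewrite -ltcR -dE.
  move=> w wz; apply: dA; rewrite /ball /= norm_modulus modulusB dE ltcR.
  exact: wz.
apply/nbhs_ballP; exists d%:C; first by rewrite /= ltcR.
by move=> w; rewrite /ball /= norm_modulus ltcR modulusB; exact: dA.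
Qed.

Lemma continuous_modulusP (f : R[i] -> R[i]) z : {for z, continuous f} <->
  forall e : R, 0 < e -> exists2 d : R, 0 < d &
    forall w, modulus (w - z) < d -> modulus (f w - f z) < e.
Proof.
split => [cf e e0|H A /nbhs_modulusP[e e0 eA]].
  have : nbhs (f z) [set w | modulus (w - f z) < e] by apply/nbhs_modulusP; exists e.
  by move/cf/nbhs_modulusP.
have [d d0 dP] := H e e0.
by apply/nbhs_modulusP; exists d => // w wz; apply/eA/dP.
Qed.

Lemma open_preimage_cplx O : open O -> open (cplx @^-1` O).
Proof.
rewrite !openE => oO p /oO/nbhs_modulusP[d d0 dO].
apply/nbhs_ballP; exists (d / 2) => /=; first by rewrite divr_gt0.
move=> q [] /=; rewrite /ball /= => h1 h2; apply: dO.
apply: (le_lt_trans (modulus_le _)) => /=.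
by rewrite (splitr d) ltrD// distrC.
Qed.

Lemma derivable_modulus (f : R[i] -> R[i]) z (e : R) : derivable f z 1 -> 0 < e ->
  exists2 d : R, 0 < d & forall w, modulus (w - z) < d ->
    modulus (f w - f z - derive1 f z * (w - z)) <= e * modulus (w - z).
Proof.
move=> /cvg_derive1 fz e0.
have : nbhs (derive1 f z) [set w | modulus (w - derive1 f z) < e].
  by apply/nbhs_modulusP; exists e.
move=> /fz /nbhs_modulusP[d d0 dP]; exists d => // w wz.
have [->|wz0] := eqVneq w z; first by rewrite !subrr mulr0 subr0 modulus0 mulr0.
have wz0' : w - z != 0 by rewrite subr_eq0.
have := dP (w - z); rewrite subr0 => /(_ wz wz0') /ltW.
rewrite subrK => H.
have -> : f w - f z - derive1 f z * (w - z) =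
    ((w - z)^-1 *: (f w - f z) - derive1 f z) * (w - z).
  rewrite mulrBl; congr (_ - _); rewrite -[_ *: _]/((w - z)^-1 * (f w - f z)).
  by rewrite mulrAC mulVf// mul1r.
by rewrite modulusM ler_wpM2r// modulus_ge0.
Qed.

Lemma derivable_lipschitz (f : R[i] -> R[i]) z (L : R) : derivable f z 1 ->
  modulus (derive1 f z) < L -> exists2 d : R, 0 < d &
    forall w, modulus (w - z) < d -> modulus (f w - f z) <= L * modulus (w - z).
Proof.
move=> fz fL; have e0 : 0 < L - modulus (derive1 f z) by rewrite subr_gt0.
have [d d0 dP] := derivable_modulus fz e0; exists d => // w /dP H.
rewrite -(subrK (derive1 f z * (w - z)) (f w - f z)).
apply: (le_trans (modulusD _ _)); rewrite modulusM; lra.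
Qed.

(** The difference quotient of [g] at [w] is the inverse of that of [f] at [g w], for
    the increment [g (h + w) - g w].  It tends to zero by continuity of [g] and is
    nonzero because [g] is injective on [V]. *)
Lemma derive1_inverse (f g : R[i] -> R[i]) w (V : set R[i]) :
  open V -> V w -> (forall w', V w' -> f (g w') = w') -> {for w, continuous g} ->
  derivable f (g w) 1 -> derive1 f (g w) != 0 ->
  derivable g w 1 /\ derive1 g w = (derive1 f (g w))^-1.
Proof.
move=> oV Vw fg cg df df0.
have H : (fun h : R[i] => h^-1 *: (g (h + w) - g w)) @ 0^' --> (derive1 f (g w))^-1.
  have fgw : f (g w) = w by exact: fg.
  have nV : \forall h \near (0 : R[i])^', V (h + w).
    have /nbhs_modulusP[d d0 dV] : nbhs w V by exact: open_nbhs_nbhs.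
    apply/nbhs_modulusP; exists d => // h; rewrite subr0 => hd _.
    by apply: dV; rewrite addrK.
  have kc : (fun h : R[i] => g (h + w) - g w) @ 0^' --> (0 : R[i])^'.
    move=> A /nbhs_modulusP[e e0 eA].
    have [d d0 dP] := (continuous_modulusP g w).1 cg e e0.
    have : \forall h \near (0 : R[i])^', h != 0 /\ modulus h < d.
      by apply/nbhs_modulusP; exists d => // h; rewrite subr0.
    apply: filterS2 nV => h Vh [h0 hd] /=; apply: eA.
      by rewrite subr0; apply: dP; rewrite addrK.
    rewrite subr_eq0; apply: contra h0 => /eqP ghw.
    by move: (fg _ Vh); rewrite ghw fgw => ghw'; apply/eqP; apply: (addIr w); rewrite add0r.
  apply: (cvg_trans _ (cvg_comp _ _ kc (cvgV df0 (cvg_derive1 df)))).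
  apply: near_eq_cvg.
  apply: filterS nV => h Vh /=.
  rewrite subrK fg// fgw addrK /GRing.scale /= invfM invrK mulrC.
  by [].
have E : (fun h : R[i] => h^-1 *: ((g \o shift w) (h *: (1 : R[i])) - g w)) =
    (fun h : R[i] => h^-1 *: (g (h + w) - g w)).
  by apply/funext => h; rewrite /= /GRing.scale /= mulr1.
have dg : derivable g w 1 by apply/cvg_ex; exists (derive1 f (g w))^-1; rewrite E.
split => //; apply: cvg_unique (cvg_derive1 dg) H; exact: norm_hausdorff.
Qed.

Lemma modulus_ReIm_lt w z (d : R) : modulus (w - z) < d ->
  `|complex.Re w - complex.Re z| < d /\ `|complex.Im w - complex.Im z| < d.
Proof.
have [h1 h2] := modReIm (w - z).
move: w z h1 h2 => [a b] [c e] /= h1 h2 h; split; [exact: le_lt_trans h1 h|exact: le_lt_trans h2 h].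
Qed.

Lemma modulus_cplx_le (p q : R * R) (s : R) : `|p.1 - q.1| <= s -> `|p.2 - q.2| <= s ->
  modulus (cplx p - cplx q) <= 2 * s.
Proof.
move=> h1 h2; apply: (le_trans (modulus_le _)) => /=; lra.
Qed.

(** The factor [2] compares the two norms: a displacement of sup norm [s] has modulus
    at most [2 * s], and the sup norm of the image is at most its modulus. *)
Lemma derivable_lipschitz_bound (O : set R[i]) (f : R[i] -> R[i]) (lam : R * R -> R) :
  (forall w, O w -> derivable f w 1) ->
  (forall p, O (cplx p) -> lam p = 2 * modulus (derive1 f (cplx p))) ->
  lipschitz_bound (cplx @^-1` O) (coords \o f \o cplx) lam.
Proof.
move=> df lamE p L Op; rewrite lamE// => hL.
have hL2 : modulus (derive1 f (cplx p)) < L / 2 by lra.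
have [d d0 dP] := derivable_lipschitz (df _ Op) hL2.
exists (d / 2); first by rewrite divr_gt0.
move=> q s Oq /andP[s0 sd] h1 h2.
have qp := modulus_cplx_le h1 h2.
have {}dP : modulus (f (cplx q) - f (cplx p)) <= L * s.
  apply: (le_trans (dP _ _)); first lra.
  have L0 : 0 <= L / 2 by apply/ltW; exact: le_lt_trans (modulus_ge0 _) hL2.
  have := ler_wpM2l L0 qp; lra.
have [g1 g2] := modReIm (f (cplx q) - f (cplx p)).
split; apply: le_trans dP.
- by move: g1; rewrite /=; case: (f (cplx q)) => ? ?; case: (f (cplx p)).
- by move: g2; rewrite /=; case: (f (cplx q)) => ? ?; case: (f (cplx p)).
Qed.

Lemma continuous_on_measurable (O : set (R * R)) (k : R * R -> R) :
  open O -> (forall p, O p -> {for p, continuous k}) ->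
  measurable_fun (O : set (plane R)) (k : plane R -> R).
Proof.
move=> oO ck; apply: (measurability _ (RGenOpens.measurableE R)).
move=> _ [_ [a [b ->] <-]]; apply: open_measurable_plane.
rewrite openE => p [Op kp]; apply: filterI; first exact: open_nbhs_nbhs.
by apply: ck => //; apply: open_nbhs_nbhs; split => //; exact: interval_open.
Qed.

Lemma continuous_ReIm_cplx (f : R[i] -> R[i]) (p : R * R) : {for cplx p, continuous f} ->
  {for p, continuous (fst \o coords \o f \o cplx)} /\
  {for p, continuous (snd \o coords \o f \o cplx)}.
Proof.
move=> /continuous_modulusP cf.
split; apply/cvgrPdist_lt => e e0; have [d d0 dP] := cf e e0;
  apply: filterS (nbhsx_ballx p (d / 2) _) => [q [/= h1 h2]|]; rewrite ?divr_gt0//;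
  rewrite distrC; have /modulus_ReIm_lt[H1 H2] // : modulus (f (cplx q) - f (cplx p)) < e;
  apply: dP; apply: (le_lt_trans (modulus_le _)) => /=;
  rewrite (splitr d) ltrD// distrC; assumption.
Qed.

Section holomorphic.
Variables (O : set R[i]) (f : R[i] -> R[i]).
Hypotheses (oO : open O) (cf : forall w, O w -> {for w, continuous f}).
Hypothesis df : forall w, O w -> derivable f w 1.

Let O2 : set (R * R) := cplx @^-1` O.
Let oO2 : open O2. Proof. exact: open_preimage_cplx. Qed.
Let mO2 : measurable (O2 : set (plane R)). Proof. exact: open_measurable_plane. Qed.

(** [f] is only controlled on [O]; extension by zero gives a map that is measurable
    on the whole plane, along which measures can be pushed forward. *)
Definition patched (p : R * R) : R * R :=
  (((fst \o coords \o f \o cplx) \_ O2) p, ((snd \o coords \o f \o cplx) \_ O2) p).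

Let mpatch1 : measurable_fun setT ((fst \o coords \o f \o cplx) \_ O2 : plane R -> R).
Proof.
apply/(measurable_restrictT _ mO2); apply: (continuous_on_measurable oO2) => p Op.
by have [] := continuous_ReIm_cplx (cf Op).
Qed.

Let mpatch2 : measurable_fun setT ((snd \o coords \o f \o cplx) \_ O2 : plane R -> R).
Proof.
apply/(measurable_restrictT _ mO2); apply: (continuous_on_measurable oO2) => p Op.
by have [] := continuous_ReIm_cplx (cf Op).
Qed.

Lemma measurable_patched : measurable_fun setT (patched : plane R -> plane R).
Proof. by apply: measurable_fun_pair. Qed.

Lemma patchedE p : O (cplx p) -> cplx (patched p) = f (cplx p).
Proof.
move=> Op; rewrite /patched /cplx /= !patchE !mem_set//=.
by rewrite -[RHS]coordsK.
Qed.

(** The derivative is the pointwise limit of the difference quotients with increment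
    [1 / (n + 1)], which are measurable. *)
Lemma measurable_modulus_derive1 :
  measurable_fun (O2 : set (plane R)) (fun p : plane R => modulus (derive1 f (cplx p))).
Proof.
pose sh (n : nat) (p : R * R) : R * R := (p.1 + n.+1%:R^-1, p.2).
pose D (n : nat) (p : R * R) := n.+1%:R *
  Num.sqrt (((patched (sh n p)).1 - (patched p).1) ^+ 2 +
            ((patched (sh n p)).2 - (patched p).2) ^+ 2).
apply: (@measurable_fun_cvg _ _ _ _ (D : nat -> plane R -> R)).
  move=> n; apply: measurable_funTS.
  have msh : measurable_fun setT (sh n : plane R -> plane R).
    apply: measurable_fun_pair; last exact: measurable_snd.
    by apply: measurable_funD => //; exact: measurable_fst.
  have m1 : measurable_fun setT (fun p : plane R => (patched (sh n p)).1).
    exact: (measurableT_comp mpatch1 msh).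
  have m2 : measurable_fun setT (fun p : plane R => (patched (sh n p)).2).
    exact: (measurableT_comp mpatch2 msh).
  apply: measurable_funM => //.
  have msq : measurable_fun setT (@Num.sqrt R) := continuous_measurable_fun (@sqrt_continuous R).
  apply: (measurableT_comp msq).
  by apply: measurable_funD; apply: measurable_funX; apply: measurable_funB.
move=> p Op; apply/cvgrPdist_le => e e0.
have [d d0 dP] := derivable_modulus (df Op) e0.
have /nbhs_modulusP[d' d'0 dO] : nbhs (cplx p) O by exact: open_nbhs_nbhs.
have D0 : 0 < Num.min d d' by rewrite lt_min d0.
apply: filterS (near_infty_natSinv_lt (PosNum D0)) => n /=; rewrite lt_min => /andP[nd nd'].
have n0 : 0 < n.+1%:R :> R by [].
have shE : cplx (sh n p) - cplx p = (n.+1%:R^-1)%:C.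
  by rewrite /sh /cplx; apply/eqP; rewrite eq_complex /= subrr addrC addKr !eqxx.
have mE : modulus (cplx (sh n p) - cplx p) = n.+1%:R^-1.
  by rewrite shE modE expr0n addr0 sqrtr_sqr ger0_norm// invr_ge0.
have Osh : O (cplx (sh n p)) by apply: dO; rewrite mE.
have DE : D n p = n.+1%:R * modulus (f (cplx (sh n p)) - f (cplx p)).
  by rewrite /D -!patchedE.
have := dP (cplx (sh n p)); rewrite mE => /(_ nd) H.
set u := f (cplx (sh n p)) - f (cplx p) in H *.
set v := derive1 f (cplx p) * (cplx (sh n p) - cplx p) in H.
have K : `|modulus u - modulus (derive1 f (cplx p)) * n.+1%:R^-1| <= e * n.+1%:R^-1.
  rewrite -{1}mE -modulusM -/v; apply: le_trans H; rewrite ler_norml; apply/andP; split.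
    have := modulusD u (v - u).
    by rewrite addrC subrK [modulus (v - u)]modulusB; lra.
  by have := modulusD (u - v) v; rewrite subrK; lra.
rewrite distrC DE -/u.
rewrite -(ler_pM2r (_ : 0 < n.+1%:R^-1)) ?invr_gt0//.
rewrite -[X in `|_| * X]ger0_norm ?invr_ge0// -normrM mulrBl.
by rewrite mulrAC mulfV ?mul1r// gt_eqF.
Qed.

End holomorphic.

Section smooth_functions.
Variable f : R[i] -> R.

Lemma continuous_real_modulusP (k : R[i] -> R) z : {for z, continuous k} ->
  forall e : R, 0 < e -> exists2 d : R, 0 < d &
    forall w, modulus (w - z) < d -> `|k w - k z| < e.
Proof.
move=> /cvgrPdist_lt ck e /ck /nbhs_modulusP[d d0 dP].
by exists d => // w /dP; rewrite distrC.
Qed.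

Lemma continuous_real_cplx (k : R[i] -> R) (p : R * R) : {for cplx p, continuous k} ->
  {for p, continuous (k \o cplx)}.
Proof.
move=> /continuous_real_modulusP ck.
apply/cvgrPdist_lt => e e0; have [d d0 dP] := ck e e0.
apply: filterS (nbhsx_ballx p (d / 2) _) => [q [/= h1 h2]|]; rewrite ?divr_gt0//.
rewrite distrC; apply: dP; apply: (le_lt_trans (modulus_le _)) => /=.
by rewrite (splitr d) ltrD// distrC.
Qed.

Lemma measurable_real_cplx (k : R[i] -> R) : continuous k ->
  measurable_fun setT (k \o cplx : plane R -> R).
Proof.
by move=> ck; apply: (continuous_on_measurable openT) => p _; exact: (continuous_real_cplx (ck _)).
Qed.

Lemma mvt_le (k : R -> R) (M a b s : R) : (forall t, derivable k t 1) ->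
  (forall t, `|t - a| <= s -> `|derive1 k t| <= M) -> `|b - a| <= s ->
  `|k b - k a| <= M * s.
Proof.
move=> dk kM bas.
have M0 : 0 <= M.
  by apply: le_trans (kM a _); rewrite ?subrr ?normr0//; exact: le_trans bas.
have ck : continuous k by move=> t; apply/differentiable_continuous/derivable1_diffP; exact: dk.
have H x y : x <= y -> `|x - a| <= s -> `|y - a| <= s -> `|y - x| <= s -> `|k y - k x| <= M * s.
  move=> xy xa ya yx.
  have [t _||c] := @MVT_segment R k (derive1 k) x y xy.
  - by split; [exact: dk|rewrite derive1E].
  - exact: continuous_subspaceT.
  rewrite in_itv /= => /andP[xc cy] ->; rewrite normrM ler_pM//.
  by apply: kM; move: xa ya; rewrite !ler_norml => /andP[? ?] /andP[? ?]; apply/andP; split; lra.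
have s0 : 0 <= s by exact: le_trans bas.
have [ab|/ltW ba] := leP a b; first by apply: H => //; rewrite subrr normr0.
by rewrite distrC; apply: H => //; rewrite ?subrr ?normr0// distrC.
Qed.

Lemma partial_le_grad_norm z :
  `|partialx f z| <= grad_norm f z /\ `|partialy f z| <= grad_norm f z.
Proof.
rewrite /grad_norm -!sqrtr_sqr; split; apply: ler_wsqrtr; rewrite ?lerDl ?lerDr sqr_ge0//.
Qed.

Hypothesis f1 : Ck 1 f.

Lemma measurable_grad_norm : measurable_fun setT (grad_norm f \o cplx : plane R -> R).
Proof.
case: f1 => _ [_ _ [cx _] [cy _]].
have msq : measurable_fun setT (@Num.sqrt R) := continuous_measurable_fun (@sqrt_continuous R).
apply: (measurableT_comp msq); apply: measurable_funD; apply: measurable_funX;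
  exact: measurable_real_cplx.
Qed.

(** Near [p] both partial derivatives are at most [M / 2] by continuity; the mean value
    theorem on a horizontal and on a vertical segment then gives the two halves. *)
Lemma upper_slope_smooth : upper_slope (f \o cplx) (fun p => 2 * grad_norm f (cplx p)).
Proof.
case: f1 => _ [dx dy [cx _] [cy _]] p M hM.
pose e := M / 2 - grad_norm f (cplx p).
have e0 : 0 < e by rewrite /e; lra.
have [d1 d10 H1] := continuous_real_modulusP (cx (cplx p)) e0.
have [d2 d20 H2] := continuous_real_modulusP (cy (cplx p)) e0.
exists (Num.min d1 d2 / 2); first by rewrite divr_gt0// lt_min d10.
move=> q s /andP[s0 sd] h1 h2.
have [g1 g2] := partial_le_grad_norm (cplx p).
have near1 r : `|r.1 - p.1| <= s -> `|r.2 - p.2| <= s ->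
    `|partialx f (cplx r)| <= M / 2 /\ `|partialy f (cplx r)| <= M / 2.
  move=> r1 r2; have := modulus_cplx_le r1 r2 => rp.
  have : modulus (cplx r - cplx p) < Num.min d1 d2 by lra.
  rewrite lt_min => /andP[/H1 K1 /H2 K2].
  have T (a b : R) : `|a| <= `|a - b| + `|b| by rewrite -{1}(subrK b a) ler_normD.
  have := T (partialx f (cplx r)) (partialx f (cplx p)).
  have := T (partialy f (cplx r)) (partialy f (cplx p)).
  by move: K1 K2; rewrite /e; split; lra.
have E1 : `|f (cplx (q.1, q.2)) - f (cplx (p.1, q.2))| <= M / 2 * s.
  apply: (mvt_le (k := fun t => f (t +i* q.2))) h1 => t.
    exact: (dx (t +i* q.2)).
  move=> tp; exact: (near1 (t, q.2) tp h2).1.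
have E2 : `|f (cplx (p.1, q.2)) - f (cplx (p.1, p.2))| <= M / 2 * s.
  apply: (mvt_le (k := fun t => f (p.1 +i* t))) h2 => t.
    exact: (dy (p.1 +i* t)).
  move=> tp; apply: (near1 (p.1, t) _ tp).2.
  by rewrite subrr normr0 ltW.
have := ler_distD (f (cplx (p.1, q.2))) (f (cplx (q.1, q.2))) (f (cplx (p.1, p.2))).
rewrite /= -!surjective_pairing in E1 E2 *; lra.
Qed.

End smooth_functions.

End complex_plane.

(** * Conformal change of variables *)

Section conformal_change_of_variables.
Context {R : realType}.
Local Notation mu := (@lebesgue_measure R \x @lebesgue_measure R)%E.
Variables (O1 O2 : set R[i]) (a b : R[i] -> R[i]).
Hypotheses (oO1 : open O1) (oO2 : open O2).
Hypothesis db : forall w, O2 w -> derivable b w 1.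
Hypotheses (ca : forall z, O1 z -> {for z, continuous a}).
Hypotheses (cb : forall w, O2 w -> {for w, continuous b}).
Hypotheses (aO : forall z, O1 z -> O2 (a z)) (baK : forall z, O1 z -> b (a z) = z).
Hypothesis dab : forall z, O1 z -> modulus (derive1 b (a z)) * modulus (derive1 a z) = 1.

Let powR_inv2 (x y : R) : 0 <= x -> x * y = 1 -> x `^ (-2) = y ^+ 2.
Proof.
move=> x0 xy; have xn0 : x != 0.
  by apply/eqP => x00; move: xy; rewrite x00 mul0r => /esym/eqP; rewrite oner_eq0.
rewrite powR_invn//; apply: (mulfI (expf_neq0 2 xn0)).
by rewrite mulfV ?expf_neq0// -exprMn xy expr1n.
Qed.

Let powR_mul16 (x : R) : 0 <= x -> x `^ (-2) * (4 * (2 * x) ^+ 2) <= 16.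
Proof.
move=> x0; have [->|xn0] := eqVneq x 0.
  by rewrite mulr0 expr0n /= !mulr0.
rewrite powR_invn// le_eqVlt; apply/orP; left; apply/eqP; field.
exact: xn0.
Qed.

(** Use [integral_comp_le] for the inverse map [b], whose Lipschitz bound is
    [2 * |b'|], with the integrand [k * |b'| `^ (-2)]: at [a z] this is
    [k (a z) * |a'(z)| ^ 2], and multiplied by the density [4 * (2 * |b'|) ^ 2] it is
    [16 * k]. *)
Lemma conformal_change (k : R * R -> R) :
  measurable_fun setT (k : plane R -> R) -> (forall p, 0 <= k p) ->
  (\int[mu]_(p in cplx @^-1` O1) (k (coords (a (cplx p))) * modulus (derive1 a (cplx p)) ^+ 2)%:E <=
   16%:E * \int[mu]_(p in cplx @^-1` O2) (k p)%:E)%E.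
Proof.
move=> mk k0.
pose U : set (plane R) := cplx @^-1` O2; pose V : set (plane R) := cplx @^-1` O1.
have mU : measurable U by apply: open_measurable_plane; exact: open_preimage_cplx.
have mV : measurable V by apply: open_measurable_plane; exact: open_preimage_cplx.
pose m (p : R * R) := modulus (derive1 b (cplx p)).
have mm : measurable_fun U (m : plane R -> R) := measurable_modulus_derive1 oO2 cb db.
pose lam : R * R -> R := (fun p => 2 * m p) \_ U.
pose H : R * R -> R := (fun p => k p * m p `^ (-2)) \_ U.
have mlam : measurable_fun setT (lam : plane R -> R).
  by apply/(measurable_restrictT _ mU); apply: measurable_funM.
have lam0 p : 0 <= lam p.
  by rewrite /lam patchE; case: ifP => // _; rewrite mulr_ge0// modulus_ge0.
have lip : lipschitz_bound U (coords \o b \o cplx) lam.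
  by apply: derivable_lipschitz_bound => // p Op; rewrite /lam patchE mem_set.
have mH : measurable_fun setT (H : plane R -> R).
  apply/(measurable_restrictT _ mU); apply: measurable_funM; first exact: measurable_funTS.
  exact: (measurableT_comp (measurable_powR _) mm).
have H0 p : 0 <= H p.
  by rewrite /H patchE; case: ifP => // _; rewrite mulr_ge0// powR_ge0.
have kV w : V w -> U (patched O1 a w) /\ (coords \o b \o cplx) (patched O1 a w) = w.
  move=> Vw; rewrite /U /= patchedE//; split; first exact: aO.
  by rewrite baK// cplxK.
have := integral_comp_le mU mV (measurable_patched oO1 ca) kV mlam lam0 lip mH H0.
have -> : (\int[mu]_(w in V) (H (patched O1 a w))%:E =
    \int[mu]_(p in V) (k (coords (a (cplx p))) * modulus (derive1 a (cplx p)) ^+ 2)%:E)%E.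
  apply: eq_integral => p; rewrite inE => Vp; congr EFin.
  have [Up _] := kV _ Vp.
  rewrite /H patchE mem_set// /m patchedE// -{1}(cplxK (patched O1 a p)) patchedE//.
  by rewrite (powR_inv2 (modulus_ge0 _) (dab Vp)).
move=> /le_trans; apply.
rewrite -ge0_integralZl//; last 2 first.
- by apply/measurable_EFinP; exact: measurable_funTS.
- by move=> p _; rewrite lee_fin.
apply: ge0_le_integral => //.
- by move=> p _; rewrite lee_fin mulr_ge0// mulr_ge0// exprn_ge0.
- apply/measurable_EFinP; apply: measurable_funTS; apply: measurable_funM => //.
  by apply: measurable_funM => //; exact: measurable_funX.
- by apply/measurable_EFinP; apply: measurable_funTS; exact: measurable_funM.
move=> p Up; rewrite -EFinM lee_fin /H /lam !patchE !mem_set//.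
by rewrite -mulrA mulrC ler_wpM2r// powR_mul16// modulus_ge0.
Qed.

End conformal_change_of_variables.

(** * Transplantation of a test function *)

Section transplantation.
Context {R : realType}.
Variables (D : set R[i]) (psi : R[i] -> R[i]) (f : R[i] -> R) (K : set R[i]).
Hypotheses (oD : open D) (dpsi : forall w, D w -> derivable psi w 1).
Hypotheses (f1 : Ck 1 f) (cK : closed K) (KD : K `<=` D).
Hypothesis fK : forall w, D w -> f (psi w) != 0 -> K w.

Definition transplant : R * R -> R := (f \o psi \o cplx) \_ (cplx @^-1` D).

Definition transplant_slope : R * R -> R :=
  (fun p => 4 * (grad_norm f (psi (cplx p)) * modulus (derive1 psi (cplx p)))) \_ (cplx @^-1` D).

(** In [D] this is the chain rule, with one factor [2] from [upper_slope_smooth] and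
    one from [derivable_lipschitz_bound].  At a point outside [D] the function
    vanishes nearby, because its support lies in the closed set [K] inside [D]. *)
Lemma upper_slope_transplant : upper_slope transplant transplant_slope.
Proof.
move=> p M; have [Dp|nDp] := pselect (D (cplx p)).
  rewrite /transplant_slope patchE mem_set// => hM.
  have g0 : 0 <= 2 * grad_norm f (psi (cplx p)) by rewrite mulr_ge0// sqrtr_ge0.
  have m0 : 0 <= 2 * modulus (derive1 psi (cplx p)) by rewrite mulr_ge0// modulus_ge0.
  have {}hM : 2 * grad_norm f (psi (cplx p)) * (2 * modulus (derive1 psi (cplx p))) < M by lra.
  have [A [B [hA hB ABM]]] := mul_lt_split g0 m0 hM.
  have B0 : 0 < B by exact: le_lt_trans hB.
  have A0 : 0 < A by exact: le_lt_trans hA.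
  have := @upper_slope_smooth R f f1 (coords (psi (cplx p))) A.
  rewrite coordsK => /(_ hA)[d1 d10 H1].
  have lip := @derivable_lipschitz_bound R D psi
    (fun p => 2 * modulus (derive1 psi (cplx p))) dpsi (fun _ _ => erefl).
  have [d2 d20 H2] := lip p B Dp hB.
  have /nbhs_ballP[e /= e0 eD] : nbhs p (cplx @^-1` D).
    by apply: open_nbhs_nbhs; split => //; exact: open_preimage_cplx.
  exists (Num.min (Num.min d1 (d1 / B)) (Num.min d2 e)).
    by rewrite !lt_min d10 d20 e0 divr_gt0.
  move=> q s; rewrite !lt_min => /and4P[s0 /andP[sd1 sdB] sd2 se] h1 h2.
  have Dq : D (cplx q).
    by apply: eD; split; rewrite /ball /= distrC; exact: le_lt_trans se.
  have [|k1 k2] := H2 q s Dq _ h1 h2; first by rewrite s0.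
  rewrite /transplant !patchE !mem_set//=.
  have := H1 (coords (psi (cplx q))) (B * s) _ k1 k2.
  rewrite /= !coordsK -ABM -mulrA; apply.
  by rewrite mulr_gt0// mulrC -ltr_pdivlMr.
rewrite /transplant_slope patchE memNset// => M0.
have : nbhs (cplx p) (~` K).
  by apply: open_nbhs_nbhs; split; [exact: closed_openC|move=> /KD].
move=> /nbhs_modulusP[d d0 dK]; exists (d / 2); first by rewrite divr_gt0.
move=> q s /andP[s0 sd] h1 h2.
have Kq : ~ K (cplx q).
  by apply: dK; apply: (le_lt_trans (modulus_cplx_le h1 h2)); lra.
rewrite /transplant [X in _ - X]patchE memNset// subr0 patchE.
case: ifPn => [|_]; last by rewrite normr0 mulr_ge0// ltW.
rewrite inE => Dq /=; have [->|/(fK Dq)//] := eqVneq (f (psi (cplx q))) 0.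
by rewrite normr0 mulr_ge0// ltW.
Qed.

Hypothesis cpsi : forall w, D w -> {for w, continuous psi}.

Let mD : measurable (cplx @^-1` D : set (plane R)).
Proof. by apply: open_measurable_plane; exact: open_preimage_cplx. Qed.

Lemma measurable_comp_conformal (k : R[i] -> R) :
  measurable_fun setT (k \o cplx : plane R -> R) ->
  measurable_fun (cplx @^-1` D : set (plane R)) (k \o psi \o cplx : plane R -> R).
Proof.
move=> mk; apply: (eq_measurable_fun (k \o cplx \o patched D psi)).
  by move=> p; rewrite inE => Dp /=; rewrite patchedE.
apply: measurable_funTS; apply: (measurableT_comp mk); exact: measurable_patched.
Qed.

Lemma measurable_transplant : measurable_fun setT (transplant : plane R -> R).
Proof.
apply/(measurable_restrictT _ mD); apply: measurable_comp_conformal.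
by apply: measurable_real_cplx; case: f1.
Qed.

Lemma measurable_transplant_slope : measurable_fun setT (transplant_slope : plane R -> R).
Proof.
apply/(measurable_restrictT _ mD); apply: measurable_funM => //; apply: measurable_funM.
  by apply: (measurable_comp_conformal (k := grad_norm f)); exact: measurable_grad_norm.
exact: measurable_modulus_derive1.
Qed.

End transplantation.

(** * Comparison of Lebesgue norms *)

Section lebesgue_norms.
Context {R : realType}.
Local Notation mu := (@lebesgue_measure R \x @lebesgue_measure R)%E.
Implicit Types (E : set (R * R)).

Lemma integral_power_le E (r s : R) : measurable (E : set (plane R)) -> (mu E < +oo)%E ->
  1 <= r <= s -> exists2 C : R, 0 <= C & forall g : R * R -> R,
    measurable_fun setT (g : plane R -> R) -> (forall p, 0 <= g p) ->
    ((\int[mu]_(p in E) (g p `^ r)%:E) `^ r^-1 <= C%:E * (\int[mu]_p (g p `^ s)%:E) `^ s^-1)%E.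
Proof.
move=> mE Efin /andP[r1 rs].
have r0 : 0 < r by lra.
have s0 : 0 < s by lra.
have mpow (g : R * R -> R) t : measurable_fun setT (g : plane R -> R) ->
    measurable_fun setT (fun p : plane R => g p `^ t).
  by move=> mg; exact: (measurableT_comp (measurable_powR t) mg).
move: rs; rewrite le_eqVlt => /predU1P[<-|rs].
  exists 1 => // g mg g0; rewrite mul1e; apply: gt0_ler_poweR.
  - by rewrite invr_ge0 ltW.
  - by rewrite in_itv /= leey andbT; apply: integral_ge0 => p _; rewrite lee_fin powR_ge0.
  - by rewrite in_itv /= leey andbT; apply: integral_ge0 => p _; rewrite lee_fin powR_ge0.
  - apply: (ge0_subset_integral _ mE measurableT) => //.
    + by apply/measurable_EFinP; exact: mpow.
    + by move=> p _; rewrite lee_fin powR_ge0.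
have sr0 : 0 < s - r by lra.
pose u := s / r; pose v := s / (s - r).
have u0 : 0 < u by rewrite divr_gt0.
have v0 : 0 < v by rewrite divr_gt0.
have uv : u^-1 + v^-1 = 1 by rewrite /u /v !invf_div; field; rewrite gt_eqF.
have mI : measurable_fun setT (\1_E : plane R -> R) by exact: measurable_indic.
have I1 : (\int[mu]_p (\1_E p `^ v)%:E = mu E)%E.
  transitivity (\int[mu]_p (\1_E p)%:E)%E; last by rewrite integral_indic// setIT.
  apply: eq_integral => p _.
  by rewrite indicE; case: (p \in E); rewrite ?powR1// powR0// gt_eqF.
exists (fine (mu E) `^ (v^-1 * r^-1)) => [|g mg g0]; first exact: powR_ge0.
have H := hoelder_integral mu (mpow g r mg) mI (fun p => powR_ge0 _ _)
  (fun p => ltac:(by [])) u0 v0 uv.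
have {}H : (\int[mu]_(p in E) (g p `^ r)%:E <=
    (\int[mu]_p (g p `^ s)%:E) `^ (r / s) * mu E `^ v^-1)%E.
  move: H; rewrite I1 [u^-1]invf_div.
  have -> : (\int[mu]_x ((g x `^ r) `^ u)%:E = \int[mu]_p (g p `^ s)%:E)%E.
    apply: eq_integral => p _; rewrite -powRrM; congr (_ `^ _)%:E.
    by rewrite /u mulrC divfK// gt_eqF.
  congr (_ <= _)%E; rewrite [RHS]integral_mkcond; apply: eq_integral => p _.
  by rewrite epatch_indic EFinM.
have Y0 : (0 <= \int[mu]_p (g p `^ s)%:E)%E by apply: integral_ge0 => p _; rewrite lee_fin powR_ge0.
set Y := (\int[mu]_p (g p `^ s)%:E)%E in H Y0 *.
apply: (@le_trans _ _ ((Y `^ (r / s) * mu E `^ v^-1) `^ r^-1)%E).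
  apply: gt0_ler_poweR => //.
  - by rewrite invr_ge0 ltW.
  - by rewrite in_itv /= leey andbT; apply: integral_ge0 => p _; rewrite lee_fin powR_ge0.
  - by rewrite in_itv /= leey andbT mule_ge0// poweR_ge0.
rewrite poweRM ?poweR_ge0// -!poweRrM -{1}(fineK (_ : mu E \is a fin_num)) ?ge0_fin_numE//.
rewrite poweR_EFin muleC (_ : r / s / r = s^-1)//.
by rewrite mulrAC mulfV ?mul1r// gt_eqF.
Qed.

(** Split [(G * m) `^ q] as [G `^ q * m `^ (2 q / p)] times [m `^ (q - 2 q / p)]: the
    first factor to the power [p / q] is [G `^ p * m ^+ 2], and the second to the
    power [p / (p - q)] is [m `^ al], by the relation between the exponents. *)
Lemma hoelder_weight E (G m : R * R -> R) (p q al : R) : 0 < q < p ->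
  q * (p - 2) = al * (p - q) ->
  measurable (E : set (plane R)) -> measurable_fun (E : set (plane R)) (G : plane R -> R) ->
  measurable_fun (E : set (plane R)) (m : plane R -> R) ->
  (forall x, 0 <= G x) -> (forall x, E x -> 0 < m x) ->
  (\int[mu]_(x in E) ((G x * m x) `^ q)%:E <=
   (\int[mu]_(x in E) (G x `^ p * m x ^+ 2)%:E) `^ (q / p) *
   (\int[mu]_(x in E) (m x `^ al)%:E) `^ ((p - q) / p))%E.
Proof.
move=> /andP[q0 qp] alE mE mG mm G0 m0.
have p0 : 0 < p by lra.
have pq0 : 0 < p - q by lra.
pose F1 : R * R -> R := (fun x => G x `^ q * m x `^ (2 * q / p)) \_ E.
pose F2 : R * R -> R := (fun x => m x `^ (q - 2 * q / p)) \_ E.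
have mpow (k : R * R -> R) t : measurable_fun (E : set (plane R)) (k : plane R -> R) ->
    measurable_fun (E : set (plane R)) (fun x : plane R => k x `^ t).
  by move=> mk; exact: (measurableT_comp (measurable_powR t) mk).
have mF1 : measurable_fun setT (F1 : plane R -> R).
  by apply/(measurable_restrictT _ mE); apply: measurable_funM; exact: mpow.
have mF2 : measurable_fun setT (F2 : plane R -> R).
  by apply/(measurable_restrictT _ mE); exact: mpow.
have F10 x : 0 <= F1 x by rewrite /F1 patchE; case: ifP => // _; rewrite mulr_ge0// powR_ge0.
have F20 x : 0 <= F2 x by rewrite /F2 patchE; case: ifP => // _; rewrite powR_ge0.
pose u := p / q; pose v := p / (p - q).
have u0 : 0 < u by rewrite divr_gt0.
have v0 : 0 < v by rewrite divr_gt0.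
have uv : u^-1 + v^-1 = 1 by rewrite /u /v !invf_div; field; rewrite gt_eqF.
have H := hoelder_integral mu mF1 mF2 F10 F20 u0 v0 uv.
have E1 : (\int[mu]_x (F1 x * F2 x)%:E = \int[mu]_(x in E) ((G x * m x) `^ q)%:E)%E.
  rewrite [RHS]integral_mkcond; apply: eq_integral => x _; rewrite /F1 /F2 !patchE.
  case: ifPn => [|_]; last by rewrite mulr0.
  rewrite inE => Ex; congr EFin; have mx := m0 x Ex.
  rewrite [RHS]powRM ?(ltW mx)// -[LHS]mulrA -powRD; last by rewrite (gt_eqF mx) implybT.
  by congr (_ * _ `^ _); ring.
have E2 : (\int[mu]_x (F1 x `^ u)%:E = \int[mu]_(x in E) (G x `^ p * m x ^+ 2)%:E)%E.
  rewrite [RHS]integral_mkcond; apply: eq_integral => x _; rewrite /F1 !patchE.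
  case: ifPn => [|_]; last by rewrite powR0// gt_eqF.
  rewrite inE => Ex; congr EFin; have mx := m0 x Ex.
  rewrite powRM ?powR_ge0// -!powRrM -powR_mulrn ?ltW//.
  congr (_ `^ _ * _ `^ _); rewrite /u; field; rewrite ?gt_eqF//.
have E3 : (\int[mu]_x (F2 x `^ v)%:E = \int[mu]_(x in E) (m x `^ al)%:E)%E.
  rewrite [RHS]integral_mkcond; apply: eq_integral => x _; rewrite /F2 !patchE.
  case: ifPn => [|_]; last by rewrite powR0// gt_eqF.
  rewrite inE => Ex; congr EFin; rewrite -powRrM; congr (_ `^ _).
  have -> : al = q * (p - 2) / (p - q) by rewrite alE mulfK// gt_eqF.
  by rewrite /v; field; rewrite !gt_eqF.
by move: H; rewrite E1 E2 E3 /u /v !invf_div.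
Qed.

End lebesgue_norms.

(** * The weighted inequality *)

Section sobolev_poincare.
Context {R : realType}.
Local Notation mu := (@lebesgue_measure R \x @lebesgue_measure R)%E.
Variables (Omega D : set R[i]) (phi psi : R[i] -> R[i]).
Hypotheses (oOmega : open Omega) (oD : open D).
Hypotheses (cphi : forall z, Omega z -> {for z, continuous phi}).
Hypotheses (cpsi : forall w, D w -> {for w, continuous psi}).
Hypotheses (dphi : forall z, Omega z -> derivable phi z 1).
Hypotheses (dpsi : forall w, D w -> derivable psi w 1).
Hypotheses (phiD : forall z, Omega z -> D (phi z)) (psiO : forall w, D w -> Omega (psi w)).
Hypotheses (phiK : forall z, Omega z -> psi (phi z) = z) (psiK : forall w, D w -> phi (psi w) = w).
Hypothesis dphi0 : forall z, Omega z -> derive1 phi z != 0.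
Hypothesis psi' : forall w, D w -> derive1 psi w = (derive1 phi (psi w))^-1.

Let D2 : set (plane R) := cplx @^-1` D.
Let Omega2 : set (plane R) := cplx @^-1` Omega.
Let mD2 : measurable D2.
Proof. by apply: open_measurable_plane; exact: open_preimage_cplx. Qed.

Let jac_inv w : D w -> modulus (derive1 phi (psi w)) * modulus (derive1 psi w) = 1.
Proof.
move=> Dw; rewrite psi'// modulusV mulfV// gt_eqF// modulus_gt0.
exact/dphi0/psiO.
Qed.

Variables (p r s q al N : R).
Hypotheses (r1 : 1 <= r) (rs : r <= s) (q1 : 1 < q) (qp : q < p) (p2 : p < 2).
Hypotheses (sE : s = 2 * q / (2 - q)) (alE : q * (p - 2) = al * (p - q)).
Hypothesis D2bounded : forall x : R * R, D2 x -> `|x.1| <= N /\ `|x.2| <= N.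
Hypothesis brennan : (\int[mu]_(x in D2) (modulus (derive1 psi (cplx x)) `^ al)%:E < +oo)%E.

Let dpsi_gt0 w : D w -> 0 < modulus (derive1 psi w).
Proof. by move=> Dw; rewrite psi'// modulusV invr_gt0 modulus_gt0; exact/dphi0/psiO. Qed.

Let D2fin : (mu D2 < +oo)%E.
Proof.
apply: (@le_lt_trans _ _ (mu (square (- `|N|, - `|N|) (2 * `|N| + 1)))).
  apply: le_measure; rewrite ?inE; [exact: mD2|exact: measurable_square|].
  move=> x /D2bounded[]; rewrite !ler_norml => /andP[? ?] /andP[? ?].
  have := ler_norm N.
  by split; rewrite /= in_itv /=; apply/andP; split; lra.
by rewrite area_square ?ltry//; have := normr_ge0 N; lra.
Qed.

Let p0 : 0 < p. Proof. exact: lt_trans (lt_trans ltr01 q1) qp. Qed.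
Let q0 : 0 < q. Proof. exact: lt_trans ltr01 q1. Qed.
Let r0 : 0 < r. Proof. exact: lt_le_trans ltr01 r1. Qed.

Let poweR_mono (X Y : \bar R) (t : R) : 0 < t -> (0 <= X)%E -> (X <= Y)%E ->
  (X `^ t^-1 <= Y `^ t^-1)%E.
Proof.
move=> t0 X0 XY; apply: gt0_ler_poweR => //; first by rewrite invr_ge0 ltW.
  by rewrite in_itv /= leey andbT.
by rewrite in_itv /= leey andbT; exact: le_trans XY.
Qed.

Let slope_algebra (W B T : \bar R) : (0 <= B < +oo)%E -> (0 <= T)%E -> (0 <= W)%E ->
  (W <= (4 `^ q)%:E * ((16%:E * T) `^ (q / p) * B `^ ((p - q) / p)))%E ->
  (W `^ q^-1 <= (4 * 16 `^ p^-1 * fine B `^ ((p - q) / p / q))%:E * T `^ p^-1)%E.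
Proof.
move=> /andP[B0 Bfin] T0 W0 WB.
have BE : B = (fine B)%:E by rewrite fineK// ge0_fin_numE.
apply: (le_trans (poweR_mono q0 W0 WB)).
have T16 : (0 <= 16%:E * T)%E by rewrite mule_ge0// lee_fin.
rewrite poweRM; [|by rewrite lee_fin powR_ge0|by rewrite mule_ge0// poweR_ge0].
rewrite poweRM ?poweR_ge0// -!poweRrM {1}BE !poweR_EFin -powRrM mulfV ?gt_eqF// powRr1//.
have -> : q / p / q = p^-1 by rewrite mulrAC mulfV ?mul1r// gt_eqF.
rewrite poweRM ?lee_fin// poweR_EFin.
by rewrite -[(_ * T `^ _ * _)%E]muleA [(T `^ _ * _)%E]muleC !muleA -!EFinM.
Qed.

Let slope_bound (f : R[i] -> R) : Ck 1 f ->
  ((\int[mu]_x (transplant_slope D psi f x `^ q)%:E) `^ q^-1 <=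
   (4 * 16 `^ p^-1 *
      fine (\int[mu]_(x in D2) (modulus (derive1 psi (cplx x)) `^ al)%:E) `^ ((p - q) / p / q))%:E *
   (\int[mu]_(x in Omega2) (grad_norm f (cplx x) `^ p)%:E) `^ p^-1)%E.
Proof.
move=> f1.
pose m (x : R * R) := modulus (derive1 psi (cplx x)).
pose G (x : R * R) := grad_norm f (psi (cplx x)).
have mm : measurable_fun D2 (m : plane R -> R) := measurable_modulus_derive1 oD cpsi dpsi.
have mG : measurable_fun D2 (G : plane R -> R).
  by apply: (measurable_comp_conformal oD cpsi (k := grad_norm f)); exact: measurable_grad_norm.
have G0 x : 0 <= G x by exact: sqrtr_ge0.
set B := (\int[mu]_(x in D2) _)%E; set T := (\int[mu]_(x in Omega2) _)%E.
have B0 : (0 <= B)%E by apply: integral_ge0 => x _; rewrite lee_fin powR_ge0.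
have T0 : (0 <= T)%E by apply: integral_ge0 => x _; rewrite lee_fin powR_ge0.
have H1 : (\int[mu]_(x in D2) (G x `^ p * m x ^+ 2)%:E <= 16%:E * T)%E.
  have := @conformal_change R D Omega psi phi oD oOmega dphi cpsi cphi psiO psiK jac_inv
    (fun x => grad_norm f (cplx x) `^ p)
    (measurableT_comp (measurable_powR p) (measurable_grad_norm f1))
    (fun x => powR_ge0 _ _).
  by under eq_integral => x _ do rewrite coordsK.
have H2 := @hoelder_weight R D2 G m p q al (introT andP (conj q0 qp)) alE mD2 mG mm G0
  (fun x Dx => dpsi_gt0 Dx).
have W1 : (\int[mu]_x (transplant_slope D psi f x `^ q)%:E =
    (4 `^ q)%:E * \int[mu]_(x in D2) ((G x * m x) `^ q)%:E)%E.
  rewrite -ge0_integralZl//; last 2 first.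
  - apply/measurable_EFinP; apply: (measurableT_comp (measurable_powR q)).
    exact: measurable_funM.
  - by move=> x _; rewrite lee_fin powR_ge0.
  rewrite [RHS]integral_mkcond; apply: eq_integral => x _.
  rewrite /transplant_slope !patchE; case: ifPn => [_|_]; last by rewrite powR0// gt_eqF.
  by rewrite -EFinM powRM//; exact: mulr_ge0 (G0 x) (modulus_ge0 _).
rewrite W1.
have W0 : (0 <= \int[mu]_(x in D2) ((G x * m x) `^ q)%:E)%E.
  by apply: integral_ge0 => x _; rewrite lee_fin powR_ge0.
have H3 : (\int[mu]_(x in D2) ((G x * m x) `^ q)%:E <=
    (16%:E * T) `^ (q / p) * B `^ ((p - q) / p))%E.
  apply: (le_trans H2); apply: lee_wpmul2r; first exact: poweR_ge0.
  rewrite -[q / p]invf_div; apply: poweR_mono => //; first by rewrite divr_gt0.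
  by apply: integral_ge0 => x _; rewrite lee_fin mulr_ge0 ?powR_ge0// exprn_ge0// modulus_ge0.
apply: slope_algebra => //.
- by rewrite B0 brennan.
- by rewrite mule_ge0// lee_fin powR_ge0.
- by apply: lee_wpmul2l => //; rewrite lee_fin powR_ge0.
Qed.

(** The whole chain of estimates.  The image by [phi] of the support of [f] is compact,
    which makes the transplanted function bounded, zero outside a box, and zero
    near the boundary of [D], as [sobolev] and [upper_slope_transplant] require. *)
Lemma weighted_sobolev : exists M : R, forall f : R[i] -> R, test_function Omega f ->
  ((\int[mu]_(x in Omega2) (`|f (cplx x)| `^ r * modulus (derive1 phi (cplx x)) ^+ 2)%:E) `^ r^-1 <=
   M%:E * (\int[mu]_(x in Omega2) (grad_norm f (cplx x) `^ p)%:E) `^ p^-1)%E.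
Proof.
have rsb : 1 <= r <= s by rewrite r1.
have [C C0 HC] := @integral_power_le R D2 r s mD2 D2fin rsb.
set c4 := 4 * 16 `^ p^-1 *
  fine (\int[mu]_(x in D2) (modulus (derive1 psi (cplx x)) `^ al)%:E) `^ ((p - q) / p / q).
exists (16 `^ r^-1 * (C * (q / (2 - q) * c4))) => f [fs fcpt fO].
have f1 : Ck 1 f := fs 1%N.
have cf : continuous f by case: f1.
pose g := transplant D psi f.
have mg : measurable_fun setT (g : plane R -> R) := measurable_transplant oD f1 cpsi.
have mgr : measurable_fun setT (fun x : plane R => `|g x| `^ r).
  apply: (measurableT_comp (measurable_powR r)); exact: measurableT_comp.
have H1 := @conformal_change R Omega D phi psi oOmega oD dpsi cphi cpsi phiD phiK
  (fun z Oz => etrans (congr2 _ erefl (congr1 (fun y => modulus (derive1 phi y)) (esym (phiK Oz))))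
     (etrans (mulrC _ _) (jac_inv (phiD Oz))))
  (fun x => `|g x| `^ r) mgr (fun x => powR_ge0 _ _).
have {}H1 : (\int[mu]_(x in Omega2) (`|f (cplx x)| `^ r * modulus (derive1 phi (cplx x)) ^+ 2)%:E <=
    16%:E * \int[mu]_(x in D2) (`|g x| `^ r)%:E)%E.
  apply: le_trans H1; rewrite le_eqVlt; apply/orP; left; apply/eqP.
  apply: eq_integral => x; rewrite inE => Ox; congr (`|_| `^ _ * _)%:E.
  rewrite /g /transplant patchE mem_set /= ?coordsK; last exact: phiD.
  by rewrite phiK.
have cptK : compact (phi @` Defs.support f).
  apply: continuous_compact fcpt; apply: continuous_in_subspaceT => z.
  by rewrite inE => /fO/cphi.
have cK : closed (phi @` Defs.support f).
  by apply: compact_closed cptK; exact: norm_hausdorff.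
have KD : phi @` Defs.support f `<=` D by move=> _ [z /fO/phiD Dz <-].
have fK w : D w -> f (psi w) != 0 -> (phi @` Defs.support f) w.
  move=> Dw fw; exists (psi w); last exact: psiK.
  exact: subset_closure.
have slope := upper_slope_transplant oD dpsi f1 cK KD fK.
have [Cb gC] : exists Cb, forall x, `|g x| <= Cb.
  have : compact (f @` Defs.support f) by exact/continuous_compact/fcpt/continuous_subspaceT.
  move=> /compact_bounded[M0 [_ fM]]; exists (Num.max (M0 + 1) 0) => x.
  have MM : M0 < Num.max (M0 + 1) 0 by rewrite lt_max ltrDl ltr01.
  rewrite /g /transplant patchE; case: ifPn => [_|_]; last by rewrite normr0 le_max lexx orbT.
  have [->|fx] := eqVneq ((f \o psi \o cplx) x) 0; first by rewrite normr0 le_max lexx orbT.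
  by apply: (fM _ MM); exists (psi (cplx x)) => //; exact: subset_closure.
have gN x : (N < `|x.1|) || (N < `|x.2|) -> g x = 0.
  move=> xN; rewrite /g /transplant patchE memNset// => /D2bounded[].
  by case/orP: xN; rewrite ltNge => /negbTE ->.
have q2 : q < 2 by exact: lt_trans qp p2.
have q12 : 1 < q < 2 by rewrite q1.
have w0 x : 0 <= transplant_slope D psi f x.
  rewrite /transplant_slope patchE; case: ifP => // _.
  by rewrite !mulr_ge0 ?sqrtr_ge0 ?modulus_ge0.
have H3 := sobolev q12 mg (measurable_transplant_slope oD dpsi f1 cpsi) w0 slope gC gN.
have H2 := HC (fun x => `|g x|) (measurableT_comp (@normr_measurable R setT) mg)
  (fun x => normr_ge0 _).
have H4 := slope_bound f1.
move: H3; rewrite -sE => H3.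
have X0 : (0 <= \int[mu]_(x in Omega2)
    (`|f (cplx x)| `^ r * modulus (derive1 phi (cplx x)) ^+ 2)%:E)%E.
  by apply: integral_ge0 => x _; rewrite lee_fin mulr_ge0 ?powR_ge0// exprn_ge0// modulus_ge0.
apply: (le_trans (poweR_mono r0 X0 H1)).
have Y0 : (0 <= \int[mu]_(x in D2) (`|g x| `^ r)%:E)%E.
  by apply: integral_ge0 => x _; rewrite lee_fin powR_ge0.
rewrite poweRM// poweR_EFin [in leRHS]EFinM -muleA lee_wpmul2l ?lee_fin ?powR_ge0//.
apply: (le_trans H2); rewrite EFinM -muleA lee_wpmul2l ?lee_fin//.
apply: (le_trans H3); rewrite [in leRHS]EFinM -muleA; apply: lee_wpmul2l => //.
by rewrite lee_fin divr_ge0 ?(ltW q0)// subr_ge0 ltW.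
Qed.

End sobolev_poincare.

Theorem proposition4p6 (R : realType) (Omega : set R[i]) (alpha0 : R)
    (phi : R[i] -> R[i]) (h : R[i] -> R) (p r : R) :
  simply_connected_domain Omega -> boundary Omega !=set0 ->
  -2 < alpha0 < 0 ->
  inverse_brennan alpha0 ->
  conformal_homeomorphism Omega unit_disc phi ->
  (forall z, Omega z -> h z = jacobian_det phi z) ->
  (`|alpha0| + 2) / (`|alpha0| + 1) < p < 2 ->
  1 <= r <= 2 * p / (2 - p) * (`|alpha0| / (2 + `|alpha0|)) ->
  2 * p / (2 - p) * (`|alpha0| / (2 + `|alpha0|)) < p / (2 - p) ->
  exists M : R, forall f : R[i] -> R, test_function Omega f ->
    (plane_integral Omega (fun z => (`|f z| `^ r * h z)%:E) `^ r^-1 <=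
     M%:E * plane_integral Omega (fun z => (grad_norm f z `^ p)%:E) `^ p^-1)%E.
Proof.
move=> scO bO /andP[_ al0] brennan [cfphi [psi [wcphi wcpsi phiP psiP]]] hE.
rewrite (ltr0_norm al0); set a := - alpha0 => /andP[ap p2] /andP[r1 rs] _.
have a0 : 0 < a by rewrite oppr_gt0.
have oO : open Omega by case: scO => -[].
have oD : open (unit_disc : set R[i]).
  rewrite openE => z; rewrite /unit_disc /= => z1; apply/nbhs_modulusP.
  exists (1 - modulus z); first by rewrite subr_gt0.
  by move=> w wz /=; have := modulusD (w - z) z; rewrite subrK; lra.
have cphi z : Omega z -> {for z, continuous phi}.
  by move: wcphi; rewrite continuous_open_subspace// => + Oz; apply; rewrite inE.
have cpsi w : unit_disc w -> {for w, continuous psi}.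
  by move: wcpsi; rewrite continuous_open_subspace// => + Dw; apply; rewrite inE.
have dpsi w : unit_disc w -> derivable psi w 1 /\ derive1 psi w = (derive1 phi (psi w))^-1.
  move=> Dw; have [Op _] := psiP w Dw; have [df df0] := cfphi _ Op.
  exact: (derive1_inverse oD Dw (fun w' Dw' => (psiP w' Dw').2) (cpsi w Dw) df df0).
have cfpsi : conformal_homeomorphism unit_disc Omega psi.
  split.
    move=> w Dw; have [dw ->] := dpsi w Dw; split => //; rewrite invr_eq0.
    by have [Op _] := psiP w Dw; have [] := cfphi _ Op.
  by exists phi.
have B := brennan Omega psi scO bO cfpsi alpha0.
have {}B : (plane_integral unit_disc (fun w => (modulus (derive1 psi w) `^ alpha0)%:E) < +oo)%E.
  by apply: B; rewrite lexx /=; lra.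
move: ap; rewrite ltr_pdivrMr; last lra.
move=> ap.
(* the solution of [q * (p - 2) = alpha0 * (p - q)], the relation that makes [alpha0]
   the exponent of the derivative in [hoelder_weight] *)
pose q := p * a / (2 - p + a).
have d0 : 0 < 2 - p + a by lra.
have p0 : 0 < p by nra.
have qE : q * (2 - p + a) = p * a by rewrite /q divfK// gt_eqF.
have q1 : 1 < q by rewrite /q ltr_pdivlMr//; lra.
have qp : q < p by rewrite /q ltr_pdivrMr// ltr_pM2l//; lra.
have alE : q * (p - 2) = alpha0 * (p - q).
  have -> : alpha0 = - a by rewrite opprK.
  lra.
have q2E : 2 - q = (2 - p) * (2 + a) / (2 - p + a).
  by rewrite /q; field; rewrite gt_eqF.
have rs' : r <= 2 * q / (2 - q).
  apply: (le_trans rs); rewrite le_eqVlt; apply/orP; left; apply/eqP.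
  rewrite q2E /q; field; apply/and3P; split; rewrite gt_eqF//; lra.
have bounded (x : R * R) : unit_disc (cplx x) -> `|x.1| <= 1 /\ `|x.2| <= 1.
  by move=> /ltW x1; have [h1 h2] := modReIm (cplx x); split; apply: le_trans x1.
have [M HM] := @weighted_sobolev R Omega unit_disc phi psi oO oD cphi cpsi
  (fun z Oz => (cfphi z Oz).1) (fun w Dw => (dpsi w Dw).1) (fun z Oz => (phiP z Oz).1)
  (fun w Dw => (psiP w Dw).1) (fun z Oz => (phiP z Oz).2) (fun w Dw => (psiP w Dw).2)
  (fun z Oz => (cfphi z Oz).2) (fun w Dw => (dpsi w Dw).2)
  p r (2 * q / (2 - q)) q alpha0 1 r1 rs' q1 qp p2 erefl alE bounded B.
exists M => f ft; have := HM f ft.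
congr (_ `^ _ <= _)%E; apply: eq_integral => x; rewrite inE => Ox.
rewrite hE// jacobian_detE//.
exact: (cfphi _ Ox).1.
Qed.
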